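(* Let $E$ be a field of characteristic $p$, $\chi:\mathbf{Q}_p^\times\to E^\times$ a smooth character and $\mathrm{M}$ a $(\psi,\Gamma)$-module. If $\Sigma$ is an infinite dimensional topologically irreducible subrepresentation of $\varprojlim_\psi\mathrm{M}$, then there exists a $(\psi,\Gamma)$-module $\mathrm{N}$ that is irreducible and free over $E[[X]]$ such that $\Sigma\cong\varprojlim_\psi\mathrm{N}$ as representations of $\mathrm{B}_2(\mathbf{Q}_p)$.
   Context: $E$ has the discrete topology. $\Gamma=\mathbf{Z}_p^\times$ ($a$ written $[a]$) acts on $E[[X]]$ by $([a]f)(X)=f((1+X)^a-1)$. A $(\psi,\Gamma)$-module is a finitely generated $E[[X]]$-module $\mathrm{M}$ with an additive map $\psi:\mathrm{M}\to\mathrm{M}$ satisfying $\psi(f(X^p)y)=f(X)\psi(y)$, and a continuous semilinear $\Gamma$-action commuting with $\psi$; it is irreducible if it has no nontrivial sub-$(\psi,\Gamma)$-module. $\varprojlim_\psi\mathrm{M}$ is the space of sequences $(y_i)_{i\in\mathbf{Z}}$ in $\mathrm{M}$ with $\psi(y_{i+1})=y_i$, topologized via the $X$-adic topology on each factor, with action of $\mathrm{B}=\mathrm{B}_2(\mathbf{Q}_p)$ (upper triangular invertible matrices): $\left(\begin{smallmatrix}z&0\\0&z\end{smallmatrix}y\right)_i=\chi(z)^{-1}y_i$; $\left(\begin{smallmatrix}1&0\\0&p\end{smallmatrix}y\right)_i=y_{i-1}=\psi(y_i)$; $\left(\begin{smallmatrix}1&0\\0&a\end{smallmatrix}y\right)_i=[a^{-1}](y_i)$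 for $a\in\mathbf{Z}_p^\times$; $\left(\begin{smallmatrix}1&z\\0&1\end{smallmatrix}y\right)_i=\psi^j((1+X)^{p^{i+j}z}y_{i+j})$ for any $j$ with $i+j\ge-\mathrm{val}_p(z)$. Topologically irreducible means no closed $\mathrm{B}$-stable subspaces other than $0$ and the whole space. *)

(* Defs.v *)
From HB Require Import structures.
From mathcomp Require Import all_boot all_order all_algebra.
From mathcomp Require Import all_classical all_reals all_analysis.
From mathcomp Require Import ring zify.

Set Implicit Arguments.
Unset Strict Implicit.
Unset Printing Implicit Defensive.

Import Order.TTheory GRing.Theory Num.Theory.

Local Open Scope classical_set_scope.
Local Open Scope ring_scope.

Record fps (E : Type) := Fps { coefs : nat -> E }.

Lemma fpsP (E : Type) (f g : fps E) : coefs f =1 coefs g <-> f = g.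
Proof.
split=> [|-> //]; case: f => f; case: g => g /= fg.
by congr Fps; apply: funext.
Qed.

HB.instance Definition _ (E : Type) := gen_eqMixin (fps E).
HB.instance Definition _ (E : Type) := gen_choiceMixin (fps E).

Section FpsRing.
Variable E : fieldType.
Implicit Types f g h : fps E.

Definition fps_add f g := Fps (fun n => coefs f n + coefs g n).
Definition fps_opp f := Fps (fun n => - coefs f n).
Definition fps_mul f g :=
  Fps (fun n => \sum_(i < n.+1) coefs f i * coefs g (n - i)).
Definition fpsC (c : E) := Fps (fun n => if n == 0 then c else 0).

Fact fps_addA : associative fps_add.
Proof. by move=> f g h; apply/fpsP => n /=; rewrite addrA. Qed.
Fact fps_addC : commutative fps_add.
Proof. by move=> f g; apply/fpsP => n /=; rewrite addrC. Qed.
Fact fps_add0 : left_id (fpsC 0) fps_add.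
Proof. by move=> f; apply/fpsP => n /=; rewrite if_same add0r. Qed.
Fact fps_addN : left_inverse (fpsC 0) fps_opp fps_add.
Proof. by move=> f; apply/fpsP => n /=; rewrite addNr if_same. Qed.

HB.instance Definition _ :=
  GRing.isZmodule.Build (fps E) fps_addA fps_addC fps_add0 fps_addN.

Definition fps_trunc n f : {poly E} := \poly_(i < n.+1) coefs f i.

Fact coef_fps_trunc n f i : (i <= n)%N -> (fps_trunc n f)`_i = coefs f i.
Proof. by move=> le_in; rewrite coef_poly ltnS le_in. Qed.

Fact coefs_fps_mul n f g i : (i <= n)%N ->
  coefs (fps_mul f g) i = (fps_trunc n f * fps_trunc n g)`_i.
Proof.
move=> le_in; rewrite coefM /=; apply: eq_bigr => -[j /=]; rewrite ltnS => le_ji _.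
by rewrite !coef_fps_trunc ?(leq_trans le_ji) // (leq_trans (leq_subr _ _)).
Qed.

Fact coef_truncM_l n f g (q : {poly E}) i : (i <= n)%N ->
  (fps_trunc n (fps_mul f g) * q)`_i = (fps_trunc n f * fps_trunc n g * q)`_i.
Proof.
move=> le_in; rewrite [LHS]coefM [RHS]coefM; apply: eq_bigr => -[j /=].
rewrite ltnS => le_ji _; have le_jn := leq_trans le_ji le_in.
by rewrite coef_fps_trunc // (coefs_fps_mul _ _ le_jn).
Qed.

Fact fps_mulC : commutative fps_mul.
Proof.
by move=> f g; apply/fpsP => n; rewrite !(@coefs_fps_mul n) // mulrC.
Qed.
Fact fps_mulA : associative fps_mul.
Proof.
move=> f g h; apply/fpsP => n; rewrite fps_mulC !(@coefs_fps_mul n) //.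
by rewrite !coef_truncM_l // mulrC mulrA.
Qed.
Fact fps_mul1 : left_id (fpsC 1) fps_mul.
Proof.
move=> f; apply/fpsP => n /=; rewrite big_ord_recl /= mul1r subn0 big1 ?addr0 //.
by move=> i _; rewrite mul0r.
Qed.
Fact fps_mulDl : left_distributive fps_mul fps_add.
Proof.
move=> f g h; apply/fpsP => n /=; rewrite -big_split /=.
by apply: eq_bigr => i _; rewrite mulrDl.
Qed.
Fact fps_1neq0 : fpsC 1 != fpsC 0.
Proof. by apply/eqP => /fpsP /(_ 0) /= /eqP; rewrite oner_eq0. Qed.

HB.instance Definition _ := GRing.Zmodule_isComNzRing.Build (fps E)
  fps_mulA fps_mulC fps_mul1 fps_mulDl fps_1neq0.

Definition fpsX : fps E := Fps (fun n => (n == 1)%:R).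

(** The composition [f(g(X))]; meaningful when [g] has no constant term, in
    which case [g ^+ k] does not contribute to the coefficients below [k]. *)
Definition fps_comp f g : fps E :=
  Fps (fun n => \sum_(k < n.+1) coefs f k * coefs (g ^+ k) n).

End FpsRing.

Arguments fpsX {E}.

(** An element of the inverse limit of the [Z/p^n], given by its residues
    [res x n] in [0, p^n). *)
Record padic_int (p : nat) (p_pr : prime p) := PadicInt {
  res : nat -> nat;
  resP : forall n, (res n.+1 %% p ^ n)%N = res n
}.

Section PadicInt.
Local Open Scope nat_scope.
Variables (p : nat) (p_pr : prime p).
Local Notation Zp := (padic_int p_pr).
Implicit Types x y z : Zp.

Lemma padicP x y : res x =1 res y <-> x = y.
Proof.
split=> [|-> //]; case: x => x xP; case: y => y yP /= /funext xy.
by move: xP; rewrite xy => xP; congr PadicInt; apply: Prop_irrelevance.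
Qed.

HB.instance Definition _ := gen_eqMixin Zp.
HB.instance Definition _ := gen_choiceMixin Zp.

Let p_gt0 : 0 < p. Proof. exact: prime_gt0. Qed.
Let pX_gt0 n : 0 < p ^ n. Proof. by rewrite expn_gt0 p_gt0. Qed.

Lemma res_lt x n : res x n < p ^ n.
Proof. by rewrite -resP ltn_mod. Qed.

Lemma res_mod x n m : n <= m -> res x m %% p ^ n = res x n.
Proof.
move=> /subnK <-; elim: (m - n)%N => [|k IHk]; first by rewrite modn_small ?res_lt.
rewrite addSn -IHk -(resP x (k + n)) modn_dvdm //.
by rewrite dvdn_exp2l // leq_addl.
Qed.

Section Mk.
Variables (f : nat -> nat) (fP : forall n, f n.+1 = f n %[mod p ^ n]).
Fact padic_mk_subproof n : (f n.+1 %% p ^ n.+1) %% p ^ n = f n %% p ^ n.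
Proof. by rewrite modn_dvdm ?fP // dvdn_exp2l. Qed.
Definition padic_mk : Zp := PadicInt p_pr padic_mk_subproof.
End Mk.

Fact padic_nat_subproof (k n : nat) : k = k %[mod p ^ n]. Proof. by []. Qed.
Definition padic_nat (k : nat) : Zp := padic_mk (padic_nat_subproof k).

Fact padic_add_subproof x y n :
  res x n.+1 + res y n.+1 = res x n + res y n %[mod p ^ n].
Proof. by rewrite -modnDm !resP. Qed.
Definition padic_add x y := padic_mk (padic_add_subproof x y).

Fact padic_mul_subproof x y n :
  res x n.+1 * res y n.+1 = res x n * res y n %[mod p ^ n].
Proof. by rewrite -modnMm !resP. Qed.
Definition padic_mul x y := padic_mk (padic_mul_subproof x y).

Fact padic_opp_subproof x n :
  p ^ n.+1 - res x n.+1 = p ^ n - res x n %[mod p ^ n].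
Proof.
have le m : res x m <= p ^ m by rewrite ltnW ?res_lt.
apply/eqP; rewrite -(eqn_modDr (res x n.+1)) subnK //.
rewrite -(modnDmr _ (res x n.+1)) resP subnK // modnn.
by rewrite -/(dvdn _ _) dvdn_exp2l.
Qed.
Definition padic_opp x := padic_mk (padic_opp_subproof x).

Fact padic_addA : associative padic_add.
Proof. by move=> x y z; apply/padicP => n /=; rewrite modnDmr modnDml addnA. Qed.
Fact padic_addC : commutative padic_add.
Proof. by move=> x y; apply/padicP => n /=; rewrite addnC. Qed.
Fact padic_add0 : left_id (padic_nat 0) padic_add.
Proof. by move=> x; apply/padicP => n /=; rewrite mod0n add0n modn_small ?res_lt. Qed.
Fact padic_addN : left_inverse (padic_nat 0) padic_opp padic_add.
Proof.
by move=> x; apply/padicP => n /=; rewrite modnDml subnK ?modnn ?mod0n // ltnW ?res_lt.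
Qed.

HB.instance Definition _ :=
  GRing.isZmodule.Build Zp padic_addA padic_addC padic_add0 padic_addN.

Fact padic_mulA : associative padic_mul.
Proof. by move=> x y z; apply/padicP => n /=; rewrite modnMmr modnMml mulnA. Qed.
Fact padic_mulC : commutative padic_mul.
Proof. by move=> x y; apply/padicP => n /=; rewrite mulnC. Qed.
Fact padic_mul1 : left_id (padic_nat 1) padic_mul.
Proof. by move=> x; apply/padicP => n /=; rewrite modnMml mul1n modn_small ?res_lt. Qed.
Fact padic_mulDl : left_distributive padic_mul padic_add.
Proof.
by move=> x y z; apply/padicP => n /=; rewrite modnMml modnDm mulnDl.
Qed.
Fact padic_1neq0 : padic_nat 1 != padic_nat 0.
Proof.
apply/eqP => /padicP /(_ 1) /=; rewrite expn1 mod0n modn_small ?prime_gt1 //.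
Qed.

HB.instance Definition _ := GRing.Zmodule_isComNzRing.Build Zp
  padic_mulA padic_mulC padic_mul1 padic_mulDl padic_1neq0.

Lemma res_natr k n : res (k%:R : Zp) n = k %% p ^ n.
Proof.
elim: k => [|k IHk]; first by [].
by rewrite -natr1 /= IHk modnDm addn1.
Qed.

Definition padic_unit : {pred Zp} := [pred x | `[< exists y, (y * x = 1)%R >]].
Definition padic_inv x := xget x [set y | y * x = 1]%R.

Fact padic_mulVr : {in padic_unit, left_inverse 1%R padic_inv *%R}.
Proof. by move=> x /asboolP ex; exact: (xgetPex x ex). Qed.
Fact padic_unitPl x y : (y * x = 1)%R -> padic_unit x.
Proof. by move=> yx1; apply/asboolP; exists y. Qed.
Fact padic_invr_out : {in [predC padic_unit], padic_inv =1 id}.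
Proof.
move=> x /negP nux; rewrite /padic_inv; case: xgetP => // y _ yx1.
by case: nux; exact: padic_unitPl yx1.
Qed.

HB.instance Definition _ := GRing.ComNzRing_hasMulInverse.Build Zp
  padic_mulVr padic_unitPl padic_invr_out.

Fact padic_idomain (x y : Zp) : (x * y = 0 -> (x == 0) || (y == 0))%R.
Proof.
have nz (t : Zp) : (t != 0)%R -> exists n, res t n != 0.
  move=> t0; apply: contrapT => /forallNP h; case/eqP: t0.
  by apply/padicP => n /=; rewrite mod0n; apply/eqP; apply: contrapT => /negP; exact: h.
have lg (t : Zp) n m : res t n != 0 -> n <= m -> 0 < res t m /\ logn p (res t m) < n.
  move=> tn nm; have tm : 0 < res t m.
    by rewrite lt0n; apply: contra tn => /eqP t0; rewrite -(res_mod _ nm) t0 mod0n.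
  split=> //; rewrite ltnNge -pfactor_dvdn //; apply: contra tn => /eqP h.
  by rewrite -(res_mod _ nm) h.
move=> xy0; apply/norP => -[/nz[n xn] /nz[m ym]].
have [x0 xl] := lg x n (n + m)%N xn (leq_addr _ _).
have [y0 yl] := lg y m (n + m)%N ym (leq_addl _ _).
have /eqP := congr1 (fun t : Zp => res t (n + m)) xy0; rewrite /= mod0n.
rewrite -/(dvdn _ _) pfactor_dvdn ?muln_gt0 ?x0 // lognM // leqNgt.
by rewrite -addnS leq_add // ltnW.
Qed.

HB.instance Definition _ :=
  GRing.ComUnitRing_isIntegral.Build Zp padic_idomain.

End PadicInt.

Definition padic (p : nat) (p_pr : prime p) := {fraction padic_int p_pr}.
HB.instance Definition _ p p_pr := GRing.Field.on (@padic p p_pr).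

Arguments padic : clear implicits.
Arguments padic {p} p_pr.
Local Notation "x %:F" := (tofrac x).

Section Padic.
Variables (p : nat) (p_pr : prime p).
Local Notation Zp := (padic_int p_pr).
Local Notation Qp := (padic p_pr).

Definition padic_nbhs (x : Zp) : set_system Zp :=
  filter_from setT (fun n => [set y | res y n = res x n]).

Fact padic_nbhs_filter x : ProperFilter (padic_nbhs x).
Proof.
apply: filter_from_proper; last by move=> n _; exists x.
apply: filter_from_filter; first by exists 0%N.
move=> m n _ _; exists (maxn m n) => // y /= yx.
by split=> /=; [rewrite -!(@res_mod _ _ _ m (maxn m n)) ?leq_maxl ?yx
               | rewrite -!(@res_mod _ _ _ n (maxn m n)) ?leq_maxr ?yx].
Qed.

Fact padic_nbhs_singleton (x : Zp) (A : set Zp) : padic_nbhs x A -> A x.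
Proof. by move=> [n _]; apply. Qed.

Fact padic_nbhs_nbhs (x : Zp) (A : set Zp) :
  padic_nbhs x A -> padic_nbhs x (padic_nbhs^~ A).
Proof. by move=> [n _ nA]; exists n => // y /= yx; exists n => // z /= zy; apply: nA; rewrite /= zy. Qed.

HB.instance Definition _ := hasNbhs.Build Zp padic_nbhs.
HB.instance Definition _ := Nbhs_isNbhsTopological.Build Zp
  padic_nbhs_filter padic_nbhs_singleton padic_nbhs_nbhs.

Lemma res_unit (x : Zp) : res x 1 != 0%N -> x \is a GRing.unit.
Proof.
move=> x1.
have cop n : coprime (p ^ n) (res x n).
  case: n => [|n]; first by rewrite coprime1n.
  rewrite coprime_pexpl // prime_coprime //; apply: contra x1 => /eqP h.
  by rewrite -(@res_mod _ _ x 1 n.+1) // expn1 h.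
have x_gt0 n : (0 < res x n.+1)%N.
  by rewrite lt0n; apply: contra x1 => /eqP h; rewrite -(@res_mod _ _ x 1 n.+1) // h mod0n.
pose v n := if n is m.+1 then (egcdn (res x m.+1) (p ^ m.+1)).1 else 0%N.
have vP n : (v n * res x n = 1 %[mod p ^ n])%N.
  case: n => [|n]; first by rewrite !modn1.
  rewrite /v; case: egcdnP => //= km kn -> _; move: (cop n.+1).
  by rewrite /coprime gcdnC => /eqP ->; rewrite modnMDl.
have vc n : (v n.+1 = v n %[mod p ^ n])%N.
  have h : (v n.+1 * res x n = 1 %[mod p ^ n])%N.
    rewrite -(@res_mod _ _ x n n.+1) // modnMmr.
    by rewrite -(@modn_dvdm (p ^ n.+1)) ?dvdn_exp2l // vP modn_dvdm ?dvdn_exp2l.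
  rewrite -[v n.+1]muln1 -modnMmr -(vP n) modnMmr mulnA [(v n.+1 * v n)%N]mulnC.
  by rewrite -mulnA -modnMmr h modnMmr muln1.
apply/asboolP; exists (padic_mk p_pr vc); apply/padicP => n /=.
by rewrite modnMml vP.
Qed.

Lemma unit_res (x : Zp) : x \is a GRing.unit -> res x 1 != 0%N.
Proof.
move=> /mulVr /(congr1 (fun t : Zp => res t 1)) /= h; apply/eqP => x0.
by move: h; rewrite x0 muln0 mod0n expn1 modn_small ?prime_gt1.
Qed.

Lemma padic_p_neq0 : (p%:R : Zp) != 0.
Proof.
apply/eqP => /padicP /(_ 2%N); rewrite res_natr /= mod0n modn_small.
  by move=> p0; move: p_pr; rewrite p0.
by rewrite -{1}(expn1 p) ltn_exp2l ?prime_gt1.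
Qed.

Lemma padic_p_neq0F : (p%:R : Qp) != 0.
Proof.
have -> : (p%:R : Qp) = (p%:R : Zp)%:F by rewrite rmorph_nat.
by rewrite tofrac_eq0 padic_p_neq0.
Qed.

Lemma padic_int_decomp (x : Zp) : x != 0 ->
  exists (n : nat) (u : Zp), u \is a GRing.unit /\ x = p%:R ^+ n * u.
Proof.
move=> x0.
have /ex_minnP[n xn nmin] : exists n, res x n != 0%N.
  apply: contrapT => /forallNP h; case/eqP: x0.
  by apply/padicP => n /=; rewrite mod0n; apply/eqP; apply: contrapT => /negP; exact: h.
case: n xn nmin => [|n] xn nmin.
  by move: xn (res_lt x 0); rewrite expn0; case: (res x 0).
have xn0 : res x n = 0%N.
  by apply/eqP; apply: contraT => /nmin; rewrite ltnn.
have dv m : (p ^ n %| res x (m + n))%N.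
  by rewrite /dvdn (@res_mod _ _ x n) ?leq_addl // xn0.
have p0 : (0 < p ^ n)%N by rewrite expn_gt0 prime_gt0.
have uP m : ((res x (m.+1 + n) %/ p ^ n) = (res x (m + n) %/ p ^ n) %[mod p ^ m])%N.
  apply/eqP; rewrite -(eqn_pmul2r p0) !muln_modl // !divnK // -expnD.
  by rewrite !(@res_mod _ _ x (m + n)) // addSn.
exists n, (padic_mk p_pr uP); split.
  apply: res_unit => /=; rewrite expn1 add1n.
  rewrite modn_small; last first.
    by rewrite -(ltn_pmul2r p0) divnK ?(dv 1%N) // -expnS res_lt.
  apply: contra xn => /eqP h; by rewrite -(divnK (dv 1%N)) add1n h mul0n.
apply/padicP => m; rewrite -natrX /= res_natr modnMml modnMmr mulnC divnK //.
by rewrite res_mod ?leq_addr.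
Qed.

Lemma padic_decomp (z : Qp) : z != 0 ->
  exists (n : int) (u : Zp), u \is a GRing.unit /\ z = p%:R ^ n * u%:F.
Proof.
have [x [y [y0 zE]]] : exists x y : Zp, y != 0 /\ z * y%:F = x%:F.
  elim/quotW: z => r; exists (frac r).1, (frac r).2; split; first exact: denom_ratioP.
  apply/eqP; rewrite !piE FracField.equivfE /FracField.mulf.
  rewrite !numden_Ratio ?mulf_neq0 ?oner_eq0 ?denom_ratioP //.
  by rewrite !mulr1 mulrC.
have y0F : y%:F != 0 by rewrite tofrac_eq0.
move: zE => /(canRL (mulfK y0F)) -> {z}.
rewrite mulf_eq0 negb_or tofrac_eq0 => /andP[/padic_int_decomp[n [u [uu ->]]] _].
have [m [v [vu yE]]] := padic_int_decomp y0.
exists (n%:Z - m%:Z), (u / v); split; first by rewrite unitrM uu unitrV.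
have vF : v%:F != 0 by rewrite tofrac_eq0; apply: contraTneq vu => ->; rewrite unitr0.
have uv : (u / v)%:F = u%:F / v%:F.
  by apply: (canRL (mulfK vF)); rewrite -rmorphM divrK.
rewrite uv yE !rmorphM !rmorphXn !rmorph_nat expfzDr ?padic_p_neq0F //.
by rewrite -exprnN -exprnP invfM mulrACA.
Qed.

Lemma padic_decomp_uniq (m n : int) (u v : Zp) :
    u \is a GRing.unit -> v \is a GRing.unit ->
  (p%:R : Qp) ^ m * u%:F = p%:R ^ n * v%:F -> m = n /\ u = v.
Proof.
have p0 := padic_p_neq0F.
wlog mn : m n u v / m <= n => [hw uu vu h|uu vu h].
  case: (lerP m n) => [|/ltW] mn; first exact: hw.
  by have [-> ->] := hw _ _ _ _ mn vu uu (esym h).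
have [k nE] : exists k : nat, n = m + k%:Z.
  by exists `|n - m|%N; rewrite gez0_abs ?subr_ge0 // [RHS]addrC subrK.
move: h; rewrite nE expfzDr // -mulrA => /(mulfI (expfz_neq0 _ p0)).
rewrite -exprnP => h; have {}h : u = p%:R ^+ k * v.
  by apply/eqP; rewrite -tofrac_eq h rmorphM rmorphXn rmorph_nat.
case: k nE h => [|k] nE h; first by rewrite addr0 h expr0 mul1r.
have := unit_res uu; rewrite h exprS -mulrA /= res_natr.
by rewrite expn1 modnn mul0n mod0n.
Qed.

(** The valuation of [z] (with the junk value [0] at [z = 0]), the unit
    [z / p^val(z)], and the inverse of the inclusion of [Z_p] in [Q_p]. *)
Definition padic_val (z : Qp) : int :=
  (xget (0, 1) [set nu : int * Zp |
     nu.2 \is a GRing.unit /\ z = p%:R ^ nu.1 * nu.2%:F]).1.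
Definition padic_ac (z : Qp) : Zp :=
  (xget (0, 1) [set nu : int * Zp |
     nu.2 \is a GRing.unit /\ z = p%:R ^ nu.1 * nu.2%:F]).2.
Definition padic_to_int (z : Qp) : Zp := xget 0 [set c | c%:F = z].

Lemma padic_valP (z : Qp) : z != 0 ->
  padic_ac z \is a GRing.unit /\ z = p%:R ^ padic_val z * (padic_ac z)%:F.
Proof.
move=> /padic_decomp[n [u [uu zE]]]; rewrite /padic_ac /padic_val.
by case: xgetP => [nu _ //|/(_ (n, u))[]].
Qed.

Lemma padic_val_eq (n : int) (u : Zp) : u \is a GRing.unit ->
  padic_val (p%:R ^ n * u%:F) = n /\ padic_ac (p%:R ^ n * u%:F) = u.
Proof.
move=> uu; have u0 : u%:F != 0.
  by rewrite tofrac_eq0; apply: contraTneq uu => ->; rewrite unitr0.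
have [|vu /esym] := @padic_valP (p%:R ^ n * u%:F).
  by rewrite mulf_neq0 // expfz_neq0 // padic_p_neq0F.
by move=> /(padic_decomp_uniq vu uu).
Qed.

Lemma padic_int_ex (z : Qp) (n : int) : (z != 0 -> 0 <= n + padic_val z) ->
  exists c : Zp, c%:F = p%:R ^ n * z.
Proof.
have [-> _|z0 /(_ isT) nz] := eqVneq z 0; first by exists 0; rewrite tofrac0 mulr0.
have [uu zE] := padic_valP z0.
exists (p%:R ^+ absz (n + padic_val z) * padic_ac z).
rewrite rmorphM rmorphXn rmorph_nat [in RHS]zE mulrA -expfzDr ?padic_p_neq0F //.
by rewrite exprnP (gez0_abs nz).
Qed.

Lemma padic_to_intK (c : Zp) : padic_to_int c%:F = c.
Proof.
rewrite /padic_to_int; case: xgetP => [d _ /eqP|/(_ c)/(_ erefl)//].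
by rewrite tofrac_eq => /eqP.
Qed.

End Padic.

Section BinomialSeries.
Variables (E : fieldType) (p : nat) (p_pr : prime p).
Local Notation Zp := (padic_int p_pr).

(** [(1 + X)^a] for [a] in [Z_p]: as [n < p^n], the binomial coefficient
    [a choose n] is congruent mod [p] to [(a mod p^n) choose n]. *)
Definition fps_onePX (a : Zp) : fps E := Fps (fun n => 'C(res a n, n)%:R).

(** [([a]f)(X) = f((1 + X)^a - 1)] *)
Definition fps_gam (a : Zp) (f : fps E) : fps E :=
  fps_comp f (fps_onePX a - 1).

Lemma coefs_Xn n i : coefs (fpsX ^+ n : fps E) i = (i == n)%:R.
Proof.
elim: n i => [|n IHn] i; first by case: i.
rewrite exprS /=; case: i => [|i].
  by rewrite big_ord_recl big_ord0 /= mul0r addr0.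
rewrite 2!big_ord_recl /= mul0r mul1r add0r subSS subn0 IHn eqSS big1 ?addr0 //.
by move=> j _; rewrite /bump /= mul0r.
Qed.

Lemma coefs_comp_Xn (f : fps E) n i : (0 < n)%N ->
  coefs (fps_comp f (fpsX ^+ n)) i = if (n %| i)%N then coefs f (i %/ n) else 0.
Proof.
move=> n0 /=; under eq_bigr do rewrite -exprM coefs_Xn.
case: ifPn => [/dvdnP[k ->]|ndv].
  rewrite mulnK //.
  have lt : (k < (k * n).+1)%N by rewrite ltnS leq_pmulr.
  rewrite (bigD1 (Ordinal lt)) //= (mulnC n k) eqxx mulr1 big1 ?addr0 // => j jk.
  case: eqP => [/eqP|]; last by rewrite mulr0.
  by rewrite (mulnC n j) eqn_pmul2r // => /eqP kj; case/eqP: jk; apply: val_inj.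
rewrite big1 // => j _; case: eqP => [ij|]; last by rewrite mulr0.
by case/negP: ndv; rewrite ij dvdn_mulr.
Qed.

Hypothesis chE : p \in [pchar E].

Lemma coef_XD1n m i : (('X + 1) ^+ m : {poly E})`_i = 'C(m, i)%:R.
Proof.
rewrite exprD1n coef_sum; under eq_bigr do rewrite coefMn coefXn.
case: (leqP i m) => [im|mi].
  rewrite (bigD1 (Ordinal (im : (i < m.+1)%N))) //= eqxx big1 ?addr0 // => j ji.
  by rewrite eq_sym (_ : (j == i :> nat) = false) ?mul0rn //; apply: contraNF ji.
rewrite bin_small // big1 // => j _.
by rewrite gtn_eqF ?mul0rn // (leq_trans _ mi) // ltnS -ltnS.
Qed.

Lemma bin_modpX m k i : (i < p ^ k)%N -> 'C(m %% p ^ k, i)%:R = 'C(m, i)%:R :> E.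
Proof.
move=> ik; rewrite -!coef_XD1n {2}(divn_eq m (p ^ k)) exprD mulnC exprM.
have chP : p \in [pchar {poly E}] by rewrite pchar_poly.
have -> : ('X + 1) ^+ (p ^ k) = 'X^(p ^ k) + 1 :> {poly E}.
  rewrite exprDn_pchar ?expr1n //.
  by rewrite (eq_pnat _ (pcharf_eq chP)) pnatX pnat_id ?orbT.
have [q ->] : exists q : {poly E},
    ('X^(p ^ k) + 1) ^+ (m %/ p ^ k) = 1 + 'X^(p ^ k) * q.
  elim: (m %/ p ^ k)%N => [|n [q qE]]; first by exists 0; rewrite mulr0 addr0.
  exists (q * ('X^(p ^ k) + 1) + 1); rewrite exprSr qE; ring.
by rewrite mulrDl mul1r coefD -mulrA coefXnM ik addr0.
Qed.

Lemma coefs_onePX (a : Zp) i k : (i < p ^ k)%N ->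
  coefs (fps_onePX a) i = 'C(res a k, i)%:R.
Proof.
move=> ik; have ii : (i < p ^ i)%N by rewrite ltn_expl ?prime_gt1.
rewrite /= -(@res_mod _ _ a i (maxn i k)) ?leq_maxl // bin_modpX //.
by rewrite -(@res_mod _ _ a k (maxn i k)) ?leq_maxr // bin_modpX.
Qed.

Lemma fps_onePX0 : fps_onePX 0 = 1.
Proof. by apply/fpsP => -[|i] /=; rewrite mod0n ?bin0 // bin0n. Qed.

Lemma fps_onePX1 : fps_onePX 1 = 1 + fpsX.
Proof.
apply/fpsP => -[|[|i]] /=.
- by rewrite bin0 addr0.
- by rewrite expn1 modn_small ?prime_gt1 // add0r.
- rewrite modn_small; first by rewrite bin_small // addr0.
  by rewrite -{1}(expn0 p) ltn_exp2l ?prime_gt1.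
Qed.

Lemma fps_onePXD a b : fps_onePX (a + b) = fps_onePX a * fps_onePX b.
Proof.
apply/fpsP => i.
have ii : (i < p ^ i)%N by rewrite ltn_expl ?prime_gt1.
rewrite (coefs_onePX _ ii) /= bin_modpX // -coef_XD1n exprD coefM.
apply: eq_bigr => j _; rewrite !coef_XD1n -!(@coefs_onePX _ _ i) //.
  by rewrite (leq_ltn_trans (leq_subr _ _)).
by rewrite (leq_ltn_trans _ ii) // -ltnS.
Qed.

Lemma fps_onePX_nat n : fps_onePX n%:R = (1 + fpsX) ^+ n.
Proof.
elim: n => [|n IHn]; first exact: fps_onePX0.
by rewrite -natr1 fps_onePXD IHn fps_onePX1 exprSr.
Qed.

Lemma fps_comp_onePX a :
  fps_comp (fps_onePX a) (fpsX ^+ p) = fps_onePX (p%:R * a).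
Proof.
have p0 : (0 < p)%N by exact: prime_gt0.
apply/fpsP => i; have ii : (i < p ^ i)%N by rewrite ltn_expl ?prime_gt1.
rewrite coefs_comp_Xn // (coefs_onePX _ ii) /= res_natr modnMml bin_modpX //.
rewrite -(coef_XD1n (p * res a i)) exprM exprDn_pchar; last first.
  have chP : p \in [pchar {poly E}] by rewrite pchar_poly.
  by rewrite (eq_pnat _ (pcharf_eq chP)) pnat_id.
rewrite expr1n exprD1n coef_sum.
under [RHS]eq_bigr do rewrite coefMn -exprM coefXn.
case: ifPn => [/dvdnP[k ki]|ndv].
  rewrite [in LHS]ki mulnK //.
  have -> : 'C(res a k, k)%:R = 'C(res a i, k)%:R :> E.
    by apply: coefs_onePX; rewrite (leq_ltn_trans _ ii) // ki leq_pmulr.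
  have kE j : (i == p * j)%N = (k == j) by rewrite ki mulnC eqn_pmul2l.
  under [RHS]eq_bigr do rewrite kE.
  case: (leqP k (res a i)) => [km|mk].
    rewrite (bigD1 (Ordinal (km : (k < (res a i).+1)%N))) //= eqxx big1 ?addr0 //.
    move=> j jk; rewrite eq_sym (_ : (j == k :> nat) = false) ?mul0rn //.
    by apply: contraNF jk.
  rewrite bin_small // big1 // => j _.
  by rewrite gtn_eqF ?mul0rn // (leq_ltn_trans _ mk) // -ltnS.
rewrite big1 // => j _; case: eqP => [ij|]; last by rewrite mul0rn.
by case/negP: ndv; rewrite ij dvdn_mulr.
Qed.

End BinomialSeries.

Definition xadic (E : fieldType) (M : lmodType (fps E)) : Type := M.

Section Xadic.
Variables (E : fieldType) (M : lmodType (fps E)).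

HB.instance Definition _ := GRing.Lmodule.copy (xadic M) M.

Definition xadic_nbhs (y : xadic M) : set_system (xadic M) :=
  filter_from setT
    (fun n => [set z | exists w : M, z = y + (fpsX ^+ n : fps E) *: w]).

Fact xadic_nbhs_filter y : ProperFilter (xadic_nbhs y).
Proof.
apply: filter_from_proper; last first.
  by move=> n _; exists y => /=; exists 0; rewrite scaler0 addr0.
apply: filter_from_filter; first by exists 0%N.
move=> m n _ _; exists (m + n)%N => // _ /= [w ->]; split=> /=.
  by exists (fpsX ^+ n *: w); rewrite scalerA -exprD.
by exists (fpsX ^+ m *: w); rewrite scalerA -exprD addnC.
Qed.

Fact xadic_nbhs_singleton (y : xadic M) (A : set (xadic M)) :
  xadic_nbhs y A -> A y.
Proof. by move=> [n _]; apply => /=; exists 0; rewrite scaler0 addr0. Qed.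

Fact xadic_nbhs_nbhs (y : xadic M) (A : set (xadic M)) :
  xadic_nbhs y A -> xadic_nbhs y (xadic_nbhs^~ A).
Proof.
move=> [n _ nA]; exists n => // _ /= [w ->]; exists n => // _ /= [v ->].
by apply: nA; exists (w + v); rewrite scalerDr addrA.
Qed.

HB.instance Definition _ := hasNbhs.Build (xadic M) xadic_nbhs.
HB.instance Definition _ := Nbhs_isNbhsTopological.Build (xadic M)
  xadic_nbhs_filter xadic_nbhs_singleton xadic_nbhs_nbhs.

End Xadic.

(** [gam a] is the action of [[a]]; its values at non-units are irrelevant.
    Joint continuity is for the [p]-adic and [X]-adic topologies. *)
Record psiGamma (p : nat) (p_pr : prime p) (E : fieldType) := PsiGamma {
  pg_mod :> lmodType (fps E);
  psi : pg_mod -> pg_mod;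
  gam : padic_int p_pr -> pg_mod -> pg_mod;
  pg_fingen : exists (n : nat) (e : 'I_n -> pg_mod),
    forall y, exists c : 'I_n -> fps E, y = \sum_i c i *: e i;
  psiD : {morph psi : y z / y + z};
  psiZ : forall (f : fps E) y, psi (fps_comp f (fpsX ^+ p) *: y) = f *: psi y;
  gamD : forall a, a \is a GRing.unit -> {morph gam a : y z / y + z};
  gamZ : forall a f y, a \is a GRing.unit ->
    gam a (f *: y) = fps_gam a f *: gam a y;
  gam1 : forall y, gam 1 y = y;
  gamM : forall a b y, a \is a GRing.unit -> b \is a GRing.unit ->
    gam (a * b) y = gam a (gam b y);
  gam_continuous :
    {within [set ay : padic_int p_pr * xadic pg_mod | ay.1 \is a GRing.unit],
      continuous (fun ay => gam ay.1 ay.2 : xadic pg_mod)};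
  psi_gam : forall a y, a \is a GRing.unit -> psi (gam a y) = gam a (psi y)
}.

Arguments psi {p p_pr E M} _ : rename.
Arguments gam {p p_pr E M} _ _ : rename.

Section PsiGammaTheory.
Variables (p : nat) (p_pr : prime p) (E : fieldType).
Implicit Types M N : psiGamma p_pr E.

(** A submodule is finitely generated, since [E[[X]]] is noetherian, and it
    inherits the continuity of the action by the Artin-Rees lemma. *)
Definition sub_psiGamma M (S : set M) : Prop :=
  [/\ S 0, forall y z, S y -> S z -> S (y + z),
      forall (f : fps E) y, S y -> S (f *: y), forall y, S y -> S (psi y)
    & forall a y, a \is a GRing.unit -> S y -> S (gam a y)].

Definition irreducible_psiGamma M : Prop :=
  forall S : set M, sub_psiGamma S -> S = [set 0] \/ S = setT.

Definition free_psiGamma M : Prop :=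
  exists (n : nat) (e : 'I_n -> M),
    forall y, exists! c : 'I_n -> fps E, y = \sum_i c i *: e i.

Definition zseq M : Type := int -> xadic M.
HB.instance Definition _ M := GRing.Lmodule.copy (zseq M) (int -> xadic M).
HB.instance Definition _ M := Topological.copy (zseq M) {ptws int -> xadic M}.

Definition limpsi M : set (zseq M) := [set y | forall i, psi (y (i + 1)) = y i].

(** A homomorphism [Q_p^* -> E^*] with open kernel; [chi 0] is irrelevant. *)
Definition smooth_character (chi : padic p_pr -> E) : Prop :=
  [/\ chi 1 = 1,
      forall x y, x != 0 -> y != 0 -> chi (x * y) = chi x * chi y
    & exists n : nat, forall a : padic_int p_pr,
        res a n.+1 = res (1 : padic_int p_pr) n.+1 -> chi (tofrac a) = 1].

(** The action of [(1 z; 0 1)], computed with the least [j >= 0] such that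
    [i + j >= - val z]; see [unip_actE]. *)
Definition unip_act M (z : padic p_pr) (y : zseq M) : zseq M := fun i =>
  let j := absz (Num.max 0 (- padic_val z - i)) in
  iter j psi (fps_onePX E (padic_to_int (p%:R ^ (i + j%:Z) * z)) *: y (i + j%:Z)).

(** [diag(1, d) = diag(1, p)^n diag(1, u)] for [d = p^n u] with [u] a unit. *)
Definition diag_act M (d : padic p_pr) (y : zseq M) : zseq M := fun i =>
  gam (padic_ac d)^-1 (y (i - padic_val d)).

Variable chi : padic p_pr -> E.

Definition central_act M (z : padic p_pr) (y : zseq M) : zseq M := fun i =>
  fpsC (chi z)^-1 *: y i.

Definition borel : set 'M[padic p_pr]_2 :=
  [set g | g \in unitmx /\ g 1 0 = 0].

(** [(a b; 0 d) = (1 b/d; 0 1) (a 0; 0 a) (1 0; 0 d/a)]; the lemmas below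
    recover the action of each kind of generator. *)
Definition borel_act M (g : 'M[padic p_pr]_2) (y : zseq M) : zseq M :=
  unip_act (g 0 1 / g 1 1)
    (central_act (g 0 0) (diag_act (g 1 1 / g 0 0) y)).

(** Closed for the topology that [V] gets from the product topology. *)
Definition closed_subrep M (V S : set (zseq M)) : Prop :=
  [/\ S `<=` V, closed (S : set (subspace V)), S 0,
      forall (c : E) y z, S y -> S z -> S (fpsC c *: y + z)
    & forall g y, borel g -> S y -> S (borel_act g y)].

Definition topologically_irreducible M (V : set (zseq M)) : Prop :=
  forall S, closed_subrep V S -> S = [set 0] \/ S = V.

Definition infinite_dimensional M (V : set (zseq M)) : Prop :=
  ~ exists (n : nat) (e : 'I_n -> zseq M), (forall i, V (e i)) /\
      forall y, V y -> exists c : 'I_n -> E, y = \sum_i fpsC (c i) *: e i.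

(** An isomorphism of topological representations, that is, a
    [B]-equivariant [E]-linear homeomorphism. *)
Definition rep_isomorphic M N (V : set (zseq M)) (W : set (zseq N)) : Prop :=
  exists (f : zseq M -> zseq N) (g : zseq N -> zseq M),
    [/\ [/\ forall y, V y -> W (f y), forall y, W y -> V (g y),
            forall y, V y -> g (f y) = y & forall y, W y -> f (g y) = y],
        {within V, continuous f} /\ {within W, continuous g},
        forall (c : E) y z, V y -> V z ->
          f (fpsC c *: y + z) = fpsC c *: f y + f z
      & forall b y, borel b -> V y -> f (borel_act b y) = borel_act b (f y)].

Section Generators.
Hypothesis chE : p \in [pchar E].
Variable M : psiGamma p_pr E.
Implicit Types (y : zseq M) (z : padic p_pr).
Local Notation onePX := (@fps_onePX E p p_pr).

Let p0 : (p%:R : padic p_pr) != 0. Proof. exact: padic_p_neq0F. Qed.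

Let unip_shift y (c : padic_int p_pr) (i : int) (j k : nat) : limpsi y ->
  iter (k + j) psi (onePX (p%:R ^+ k * c) *: y (i + (k + j)%N%:Z)) =
  iter j psi (onePX c *: y (i + j%:Z)).
Proof.
move=> yP; elim: k => [|k <-]; first by rewrite expr0 mul1r.
rewrite addSn iterSr exprS -mulrA -(fps_comp_onePX chE) psiZ.
by rewrite -addn1 PoszD addrA yP.
Qed.

Lemma unip_actE z y (i : int) (j : nat) (c : padic_int p_pr) :
    limpsi y -> tofrac c = p%:R ^ (i + j%:Z) * z ->
  unip_act z y i = iter j psi (onePX c *: y (i + j%:Z)).
Proof.
move=> yP; rewrite /unip_act; set j0 := absz _ => cE.
have [c0 c0E] : exists c0 : padic_int p_pr, tofrac c0 = p%:R ^ (i + j0%:Z) * z.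
  by apply: padic_int_ex; rewrite /j0; lia.
rewrite -c0E padic_to_intK.
wlog le : j j0 c c0 cE c0E / (j <= j0)%N => [hw|].
  by case: (leqP j j0) => [|/ltnW] le; [|symmetry]; exact: hw.
rewrite -(unip_shift c i j (j0 - j) yP) subnK //; congr (iter _ _ (onePX _ *: _)).
apply/eqP; rewrite -tofrac_eq c0E tofracM tofracXn rmorph_nat cE mulrA.
by rewrite exprnP -expfzDr // addrCA -PoszD subnK.
Qed.

Lemma unip_act_limpsi z y : limpsi y -> limpsi (unip_act z y).
Proof.
move=> yP i; have [n [c cE]] : exists (j : nat) (c : padic_int p_pr),
    tofrac c = p%:R ^ (i + 1 + j%:Z) * z.
  exists (absz (Num.max 0 (- padic_val z - (i + 1)))).
  by apply: padic_int_ex; lia.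
have e : i + 1 + n%:Z = i + n.+1%:Z by rewrite -addrA -PoszD.
rewrite (unip_actE yP cE); move: cE; rewrite e => cE.
by rewrite (unip_actE yP cE).
Qed.

Let fps_compC (c : E) g : fps_comp (fpsC c) g = fpsC c.
Proof.
apply/fpsP => n /=; rewrite big_ord_recl /= big1 ?addr0 => [|k _]; last first.
  by rewrite mul0r.
by case: n => [|n]; rewrite ?mulr1 ?mulr0.
Qed.

Lemma diag_act_limpsi (d : padic p_pr) y :
  d != 0 -> limpsi y -> limpsi (diag_act d y).
Proof.
move=> /padic_valP[uu _] yP i; rewrite /diag_act psi_gam ?unitrV //.
by rewrite addrAC yP.
Qed.

Lemma central_act_limpsi z y : limpsi y -> limpsi (central_act z y).
Proof.
by move=> yP i; rewrite /central_act -{1}(fps_compC _ (fpsX ^+ p)) psiZ yP.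
Qed.

Lemma borelE (g : 'M[padic p_pr]_2) :
  borel g <-> [/\ g 0 0 != 0, g 1 1 != 0 & g 1 0 = 0].
Proof.
have det : g 1 0 = 0 -> \det g = g 0 0 * g 1 1.
  move=> g10; rewrite -det_tr det_trig; last first.
    apply/is_trig_mxP => -[[|[]]] //= i [[|[|]]] //= j _; rewrite mxE.
    by rewrite -[RHS]g10; congr (g _ _); apply: val_inj.
  rewrite !big_ord_recl big_ord0 mulr1 !mxE.
  by congr (g _ _ * g _ _); apply: val_inj.
rewrite /borel /= unitmxE unitfE; split=> [[dg g10]|[g00 g11 g10]].
  by move: dg; rewrite det // mulf_eq0 negb_or => /andP[].
by rewrite det // mulf_neq0.
Qed.

Lemma borel_act_limpsi g y : borel g -> limpsi y -> limpsi (borel_act g y).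
Proof.
move=> /borelE[g00 g11 _] yP; apply: unip_act_limpsi; apply: central_act_limpsi.
by apply: diag_act_limpsi => //; rewrite mulf_neq0 ?invr_neq0.
Qed.

Let unip_act0 y : limpsi y -> unip_act 0 y = y.
Proof.
move=> yP; apply: funext => i.
by rewrite (@unip_actE _ _ _ 0 0) ?tofrac0 ?mulr0 //= fps_onePX0 scale1r addr0.
Qed.

Let diag_act1 y : diag_act 1 y = y.
Proof.
apply: funext => i; rewrite /diag_act.
have [] := padic_val_eq 0 (unitr1 (padic_int p_pr)).
by rewrite expr0z tofrac1 mulr1 => -> ->; rewrite invr1 gam1 subr0.
Qed.

Definition upper (a b d : padic p_pr) : 'M[padic p_pr]_2 :=
  \matrix_(i, j) (if i == j then if i == 0 then a else d else if i == 0 then b else 0).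

Lemma borel_act_central z y : limpsi y -> z != 0 ->
  borel_act (upper z 0 z) y = fun i => fpsC (chi z)^-1 *: y i.
Proof.
move=> yP z0; rewrite /borel_act !mxE /= mul0r divff // diag_act1 unip_act0 //.
exact: central_act_limpsi.
Qed.

Hypothesis chi1 : chi 1 = 1.
Let central_act1 y : central_act 1 y = y.
Proof. by apply: funext => i; rewrite /central_act chi1 invr1 scale1r. Qed.

Lemma borel_act_p y : limpsi y ->
  borel_act (upper 1 0 p%:R) y = fun i => y (i - 1).
Proof.
move=> yP; rewrite /borel_act !mxE /= mul0r divr1 central_act1.
rewrite unip_act0; last exact: diag_act_limpsi.
apply: funext => i; rewrite /diag_act.
have [] := padic_val_eq 1 (unitr1 (padic_int p_pr)).
by rewrite expr1z tofrac1 mulr1 => -> ->; rewrite invr1 gam1.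
Qed.

Lemma borel_act_unit (a : padic_int p_pr) y : a \is a GRing.unit -> limpsi y ->
  borel_act (upper 1 0 (tofrac a)) y = fun i => gam a^-1 (y i).
Proof.
move=> ua yP; have a0 : tofrac a != 0.
  by rewrite tofrac_eq0; apply: contraTneq ua => ->; rewrite unitr0.
rewrite /borel_act !mxE /= mul0r divr1 central_act1.
rewrite unip_act0; last exact: diag_act_limpsi.
apply: funext => i; rewrite /diag_act.
by have [] := padic_val_eq 0 ua; rewrite expr0z mul1r => -> ->; rewrite subr0.
Qed.

Lemma borel_act_unip z y : borel_act (upper 1 z 1) y = unip_act z y.
Proof. by rewrite /borel_act !mxE /= !divr1 diag_act1 central_act1. Qed.

End Generators.

End PsiGammaTheory.

(* Main.v *)
Require Import Defs.
From HB Require Import structures.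
From mathcomp Require Import all_boot all_order all_algebra.
From mathcomp Require Import all_classical all_reals all_analysis.
From mathcomp Require Import ring zify.

Set Implicit Arguments.
Unset Strict Implicit.
Unset Printing Implicit Defensive.

Import Order.TTheory GRing.Theory Num.Theory.

Local Open Scope classical_set_scope.
Local Open Scope ring_scope.

(** Let [A] be the X-adic closure of the set of components [y_0] of the
    sequences [y] in [Sigma]. It is a sub-(psi, Gamma)-module of [M], and
    [Sigma] is the inverse limit of [A]: approximating [y_k] by a component of
    an element of [Sigma] approximates all [y_i], [i <= k], at once, since
    [psi] is continuous.  Let [K] be the largest submodule of [A] on which
    [psi] is nilpotent. As [psi^m K = 0] for some [m], the map
    [(q_i) |-> (psi^m (lift of q_(i+m)))] inverts the projection from the
    inverse limit of [A] to that of [N = A / K].  A submodule [S] of [A] whose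
    inverse limit is trivial is [psi]-nilpotent, hence contained in [K]: if
    not, either the ranks of the [psi^k S] stabilise at a positive value, and
    the contraction [psi (X^(pm) y) = X^m psi y] gives a nonzero lattice [L]
    with [L <= psi L], or [psi] has a nonzero stable image on the [X]-torsion
    of [S].  So irreducibility of [Sigma] makes [N] irreducible. If [X] killed
    a nonzero element of [N] it would kill [N], which would then be finite
    dimensional with [psi] bijective, and so would be [Sigma]. *)

(** * Power series *)

Section PowerSeries.
Variable E : fieldType.
Implicit Types f g h : fps E.

Lemma coefs_XnM n f i :
  coefs (fpsX ^+ n * f) i = if (i < n)%N then 0 else coefs f (i - n).
Proof.
have XM g j : coefs (fpsX * g) j = if j is k.+1 then coefs g k else 0.
  case: j => [|j] /=; first by rewrite big_ord_recl big_ord0 /= mul0r addr0.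
  rewrite 2!big_ord_recl /= mul0r mul1r add0r subSS subn0 big1 ?addr0 //.
  by move=> k _; rewrite /bump /= mul0r.
elim: n i => [|n IHn] i; first by rewrite expr0 mul1r subn0.
by rewrite exprS -mulrA XM; case: i => [//|i]; rewrite IHn subSS.
Qed.

Lemma fps_Xn_dvd n f :
  (forall i, (i < n)%N -> coefs f i = 0) -> exists g, f = fpsX ^+ n * g.
Proof.
move=> f0; exists (Fps (fun i => coefs f (i + n))).
apply/fpsP => i; rewrite coefs_XnM; case: ltnP => [/f0 //|ni] /=.
by rewrite subnK.
Qed.

Lemma fps_headE f : exists g, f = fpsC (coefs f 0) + fpsX * g.
Proof.
have [|g gE] := @fps_Xn_dvd 1 (f - fpsC (coefs f 0)); last first.
  by exists g; rewrite -(expr1 fpsX) -gE addrC subrK.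
by case=> // _; rewrite /= subrr.
Qed.

(** The inverse is the geometric series in X g, obtained by composing the all-ones series with [t].
    Its coefficient [n] only depends on a finite partial sum, which telescopes modulo X^(n+1). *)
Lemma fps_geom g : exists h, h * (1 - fpsX * g) = 1.
Proof.
pose t := fpsX * g; pose G := fps_comp (Fps (fun=> 1)) t.
exists G; apply/fpsP => n.
have tlow k i : (i < k)%N -> coefs (t ^+ k) i = 0.
  by move=> ik; rewrite exprMn coefs_XnM ik.
have [w wE] : exists w, G = \sum_(k < n.+1) t ^+ k + fpsX ^+ n.+1 * w.
  have [i lt_in|w wE] := @fps_Xn_dvd n.+1 (G - \sum_(k < n.+1) t ^+ k).
    rewrite /=.
    have cs (F : nat -> fps E) m : coefs (\sum_(k < m) F k) i = \sum_(k < m) coefs (F k) i.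
      elim: m => [|m IHm]; first by rewrite !big_ord0 /=; case: eqP.
      by rewrite !big_ord_recr -IHm.
    rewrite cs; under eq_bigr do rewrite mul1r.
    rewrite (big_ord_widen n.+1 (fun k => coefs (t ^+ k) i)) // big_mkcond -sumrB.
    by apply: big1 => k _; case: ltnP => [_|/tlow ->]; rewrite subrr.
  by exists w; rewrite -wE addrC subrK.
have SE : (\sum_(k < n.+1) t ^+ k) * (1 - t) = 1 - t ^+ n.+1.
  by rewrite -opprB mulrN mulrC -subrX1 opprB.
have -> : G * (1 - t) = 1 + fpsX ^+ n.+1 * (w * (1 - t) - g ^+ n.+1).
  by rewrite wE mulrDl SE exprMn; ring.
have -> (a b : fps E) : coefs (a + b) n = coefs a n + coefs b n by [].
by rewrite coefs_XnM ltnSn addr0.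
Qed.

Lemma fps_unit f : coefs f 0 != 0 -> exists g, g * f = 1.
Proof.
move=> f0; have [g gE] := fps_headE f; set c := coefs f 0 in f0 gE.
have cV : fpsC c^-1 * fpsC c = 1 :> fps E.
  apply/fpsP => -[|n] /=; first by rewrite big_ord_recl big_ord0 /= mulVf // addr0.
  by rewrite big1 // => i _; case: eqP => [->|_]; rewrite ?mul0r // subn0 mulr0.
have [h hE] := fps_geom (- (fpsC c^-1 * g)).
exists (h * fpsC c^-1); rewrite gE -[RHS]hE -cV; ring.
Qed.

Lemma fps_unit_or_X f : (exists g, g * f = 1) \/ exists g, f = fpsX * g.
Proof.
have [f0|/fps_unit] := eqVneq (coefs f 0) 0; last by left.
right; rewrite -[fpsX]expr1; apply: fps_Xn_dvd; by case.
Qed.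

(** Here [v] is the X-adic valuation, [h] the unit part and [g] the inverse of [h]. The first
    equation turns a coefficient [f] into a power of X, the second shows that this power divides
    [f]. *)
Lemma fps_valP f : f != 0 ->
  exists v g h, g * f = fpsX ^+ v /\ f = fpsX ^+ v * h.
Proof.
move=> f0; have /ex_minnP[v fv vmin] : exists v, coefs f v != 0.
  apply: contrapT => /forallNP h; case/eqP: f0; apply/fpsP => n /=.
  by rewrite if_same; apply/eqP; apply: contrapT => /negP; exact: h.
have [i iv|h hE] := @fps_Xn_dvd v f.
  by apply/eqP; apply: contraTT iv => /vmin; rewrite -leqNgt.
have [|g gE] := @fps_unit h.
  by move: fv; rewrite {1}hE coefs_XnM ltnn subnn.
by exists v, g, h; rewrite {1}hE mulrCA gE mulr1.
Qed.

(** Coefficient [i] of a composition only involves the powers up to [i] of the inner series. Applied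
    to [fps_gam], this shows that Gamma preserves the X-adic filtration. *)
Lemma fps_comp_Xn_dvd n h : exists g, fps_comp (fpsX ^+ n) h = fpsX ^+ n * g.
Proof.
apply: fps_Xn_dvd => i lt_in; rewrite /= big1 // => k _.
rewrite coefs_Xn (_ : (k == n :> nat) = false) ?mul0r //.
by apply/negbTE; rewrite neq_ltn (leq_ltn_trans _ lt_in) // -ltnS.
Qed.

Lemma fps_compC c h : fps_comp (fpsC c) h = fpsC c.
Proof.
apply/fpsP => n /=; rewrite big_ord_recl /= big1 ?addr0 => [|k _]; last first.
  by rewrite mul0r.
by case: n => [|n]; rewrite ?mulr1 ?mulr0.
Qed.

Lemma fps_comp_XnXp n p : (0 < p)%N ->
  fps_comp (fpsX ^+ n) (fpsX ^+ p) = fpsX ^+ (p * n) :> fps E.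
Proof.
move=> p0; apply/fpsP => i; rewrite coefs_comp_Xn // !coefs_Xn.
case: ifPn => [/dvdnP[k ->]|ndv].
  by rewrite mulnK // mulnC eqn_pmul2l.
by case: eqP => // ie; case/negP: ndv; rewrite ie dvdn_mulr.
Qed.

End PowerSeries.

(** * Submodules, spans of lists and decreasing chains *)

Section Submodules.
Variables (R : comNzRingType) (V : lmodType R).
Implicit Types (A B : set V) (s t : seq V) (x y z w : V).

Definition submodule A := A 0 /\ forall c y z, A y -> A z -> A (c *: y + z).

(** The recursion splits off one generator at a time, which is the shape of the inductions below. *)
Fixpoint lspan s : set V :=
  if s is x :: s' then [set y | exists c w, lspan s' w /\ y = c *: x + w]
  else [set 0].

Section Theory.
Variable A : set V.
Hypothesis subA : submodule A.

Lemma submodule0 : A 0. Proof. exact: subA.1. Qed.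

Lemma submoduleZ c y : A y -> A (c *: y).
Proof. by move=> Ay; rewrite -[_ *: _]addr0; apply: subA.2 => //; exact: subA.1. Qed.

Lemma submoduleD y z : A y -> A z -> A (y + z).
Proof. by move=> Ay Az; rewrite -[y]scale1r; exact: subA.2. Qed.

Lemma submoduleN y : A y -> A (- y).
Proof. by rewrite -scaleN1r; exact: submoduleZ. Qed.

Lemma submoduleB y z : A y -> A z -> A (y - z).
Proof. by move=> Ay /submoduleN; exact: submoduleD. Qed.

Lemma submodule_sum (I : Type) (r : seq I) (F : I -> V) :
  (forall i, A (F i)) -> A (\sum_(i <- r) F i).
Proof. by move=> AF; elim/big_ind: _ => //; [exact: submodule0|exact: submoduleD]. Qed.

Lemma lspan_sub s : (forall x, x \in s -> A x) -> lspan s `<=` A.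
Proof.
elim: s => [|x s IHs] As y /=; first by move=> ->; exact: submodule0.
move=> [c [w [sw ->]]]; apply: subA.2; first exact/As/mem_head.
by apply: IHs sw => z zs; apply: As; rewrite inE zs orbT.
Qed.

End Theory.

Lemma lspan_submodule s : submodule (lspan s).
Proof.
elim: s => [|x s [s0 sP]] /=.
  by split=> // c _ _ -> ->; rewrite scaler0 addr0.
split; first by exists 0, 0; rewrite scale0r addr0.
move=> c _ _ [a [w [sw ->]]] [b [v [sv ->]]].
exists (c * a + b), (c *: w + v); split; first exact: sP.
by rewrite scalerDr scalerDl scalerA addrACA.
Qed.

Lemma mem_lspan s x : x \in s -> lspan s x.
Proof.
elim: s => [//|y s IHs]; rewrite inE => /orP[/eqP ->|/IHs sx] /=.
  by exists 1, 0; rewrite scale1r addr0; split=> //; exact: (lspan_submodule s).1.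
by exists 0, x; rewrite scale0r add0r.
Qed.

Lemma setI_submodule A B : submodule A -> submodule B -> submodule (A `&` B).
Proof.
move=> [A0 AP] [B0 BP]; split=> [//|c y z [Ay By] [Az Bz]]; split; [exact: AP|exact: BP].
Qed.

Lemma ker_submodule c : submodule [set y | c *: y = 0].
Proof.
split=> [|d y z /= y0 z0]; first by rewrite /= scaler0.
by rewrite scalerDr z0 scalerA mulrC -scalerA y0 scaler0 addr0.
Qed.

(** The common source of the two stabilisation results for decreasing chains:
    with [T] the powers of [X] it says that the rank stabilises, with
    [T = {1}] that the chain does. *)
Lemma chain_stable (T : set R) s (A : nat -> set V) :
    T 1 -> (forall c d, T c -> T d -> T (c * d)) ->
    (forall c, (exists g, T (g * c)) \/ forall x, x \in s -> c *: x = 0) ->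
    (forall k, submodule (A k)) -> (forall k, A k.+1 `<=` A k) ->
    A 0%N `<=` lspan s ->
  exists k0, forall k, (k0 <= k)%N -> forall y, A k0 y ->
    exists2 c, T c & A k (c *: y).
Proof.
move=> T1 TM; elim: s A => [|x s IHs] A TP subA decA As.
  exists 0%N => k _ y /As /= ->; exists 1 => //.
  by rewrite scaler0; exact: submodule0.
have dec m n : (m <= n)%N -> A n `<=` A m.
  move=> /subnK <-; elim: (n - m)%N => [//|k IHk]; rewrite addSn.
  exact: subset_trans (decA _) IHk.
have [c|k|k y [/decA Ay sy]|y [] //|k1 k1P] :=
    IHs (fun k => A k `&` lspan s).
- by case: (TP c) => [|h]; [left|right=> y ys; apply: h; rewrite inE ys orbT].
- exact/setI_submodule/lspan_submodule.
- by split.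
(* Either from some stage on the coefficients of [x] divide no element of [T], hence kill [x], and
   the chain lies in the span of [s]; or at every stage some coefficient divides an element of
   [T]. *)
have [[k2 k2P]|noT] := pselect (exists k, forall c w, lspan s w ->
    A k (c *: x + w) -> ~ exists g, T (g * c)).
  exists (maxn k1 k2) => k; rewrite geq_max => /andP[k1k k2k] y Ay.
  have sy : lspan s y.
    have [c [w [sw yE]]] := As _ (dec _ _ (leq0n _) _ Ay).
    have := k2P c w sw; rewrite -yE => /(_ (dec _ _ (leq_maxr _ _) _ Ay)) nT.
    by case: (TP c) => // /(_ x (mem_head _ _)) c0; rewrite yE c0 add0r.
  have [|c Tc [Ac _]] := k1P _ k1k y; last by exists c.
  by split=> //; exact: dec (leq_maxl _ _) _ Ay.
exists k1 => k k1k y Ay.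
have [c [w [sw [Az [g Tg]]]]] : exists c w, lspan s w /\ A k (c *: x + w) /\
    exists g, T (g * c).
  apply: contrapT => h; apply: noT; exists k => c w sw Acw gT; apply: h.
  by exists c, w.
have [d [v [sv yE]]] := As _ (dec _ _ (leq0n _) _ Ay).
(* Up to the factor [g * c] from [T], subtracting a multiple of an element of [A k] removes [x] from
   [y]; the induction hypothesis then applies to [z]. *)
pose z := (g * c) *: y - (d * g) *: (c *: x + w).
have [|e Te [Ae _]] := k1P _ k1k z.
  split; first by apply: submoduleB => //; apply: submoduleZ => //; exact: dec Az.
  have -> : z = (g * c) *: v - (d * g) *: w.
    rewrite /z yE !scalerDr !scalerA opprD addrACA.
    by rewrite (_ : g * c * d = d * g * c) ?subrr ?add0r //; ring.
  by apply: submoduleB; try apply: submoduleZ => //; exact: lspan_submodule.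
exists (e * (g * c)); first exact: TM.
rewrite -scalerA (_ : (g * c) *: y = z + (d * g) *: (c *: x + w)); last first.
  by rewrite /z subrK.
by rewrite scalerDr; apply: submoduleD => //; apply: submoduleZ => //; apply: submoduleZ.
Qed.

Lemma lspan_imageP (I : Type) (r : seq I) (F : I -> V) (c : I -> R) :
  lspan (map F r) (\sum_(i <- r) c i *: F i).
Proof.
elim: r => [|i r IHr] /=; first by rewrite big_nil.
by rewrite big_cons; exists (c i), (\sum_(j <- r) c j *: F j).
Qed.

Lemma lspan_nthP s y : lspan s y ->
  exists c : 'I_(size s) -> R, y = \sum_i c i *: s`_i.
Proof.
elim: s y => [|x s IHs] y /=; first by move=> ->; exists (fun=> 0); rewrite big_ord0.
move=> [a [w [/IHs[c ->] ->]]].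
exists (fun i => if unlift ord0 i is Some j then c j else a).
rewrite big_ord_recl unlift_none; congr (_ + _); apply: eq_bigr => i _.
by rewrite liftK.
Qed.

End Submodules.

(** * Noetherianity over power series *)

Section PowerSeriesModules.
Variables (E : fieldType) (V : lmodType (fps E)).
Implicit Types (A B S : set V) (s t : seq V) (x y z w : V).
Local Notation X := (fpsX : fps E).

(** The coefficients of [x] in elements of [A] are all zero or all multiples of X^v with [v]
    minimal. One element of [A] with coefficient X^v, together with generators of the part of [A]
    inside the span of [s], then suffices. *)
Lemma submodule_fingen s A : submodule A -> A `<=` lspan s ->
  exists t, A = lspan t.
Proof.
elim: s A => [|x s IHs] A subA As.
  exists [::]; apply/seteqP; split=> // y /= ->; exact: submodule0.
have [t tE] := IHs (A `&` lspan s) (setI_submodule subA (lspan_submodule s))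
  (@subIsetr _ _ _).
have [h|/existsNP[v0 /contrapT v0P]] :=
    pselect (forall v, ~ exists w, lspan s w /\ A (X ^+ v *: x + w)).
  exists t; rewrite -tE; apply/seteqP; split=> [y Ay|y []//]; split=> //.
  have [c [w [sw yE]]] := As _ Ay.
  have [c0|/fps_valP[v [g [_ [gc _]]]]] := eqVneq c 0; first by rewrite yE c0 scale0r add0r.
  case: (h v); exists (g *: w); split; first by apply: submoduleZ => //; exact: lspan_submodule.
  by rewrite -gc -scalerA -scalerDr -yE; exact: submoduleZ.
have /ex_minnP[v /asboolP[w [sw Aw]] vmin] :
  exists v, `[< exists w, lspan s w /\ A (X ^+ v *: x + w) >] by exists v0; exact/asboolP.
exists ((X ^+ v *: x + w) :: t); apply/seteqP; split; last first.
  move=> _ [c [u [tu ->]]]; apply: subA.2 => //.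
  by have [] : (A `&` lspan s) u by rewrite tE.
move=> y Ay; have [c [u [su yE]]] := As _ Ay.
have [d cE] : exists d, c = X ^+ v * d.
  have [->|c0] := eqVneq c 0; first by exists 0; rewrite mulr0.
  have [k [g [h [gc hE]]]] := fps_valP c0.
  have kv : (v <= k)%N.
    apply: vmin; apply/asboolP; exists (g *: u).
    split; first by apply: submoduleZ => //; exact: lspan_submodule.
    by rewrite -gc -scalerA -scalerDr -yE; exact: submoduleZ.
  by exists (X ^+ (k - v) * h); rewrite mulrA -exprD subnKC.
exists d, (y - d *: (X ^+ v *: x + w)); split; last by rewrite addrC subrK.
rewrite -tE; split; first by apply: submoduleB => //; exact: submoduleZ.
rewrite yE cE scalerDr scalerA [d * _]mulrC opprD addrACA subrr add0r.
by apply: submoduleB => //; [|apply: submoduleZ => //]; exact: lspan_submodule.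
Qed.

End PowerSeriesModules.

Lemma exists_uniform_bound (T : eqType) (t : seq T) (P : T -> nat -> Prop) :
    (forall x m n, (m <= n)%N -> P x m -> P x n) ->
    (forall x, x \in t -> exists n, P x n) ->
  exists n, forall x, x \in t -> P x n.
Proof.
move=> Pmon; elim: t => [|x t IHt] Pt; first by exists 0%N.
have [n nP] := Pt x (mem_head _ _).
have [|m mP] := IHt; first by move=> y yt; apply: Pt; rewrite inE yt orbT.
exists (maxn n m) => y; rewrite inE => /orP[/eqP ->|/mP].
  by apply: Pmon nP; exact: leq_maxl.
by apply: Pmon; exact: leq_maxr.
Qed.

(** * Finitely generated modules over power series *)

Section CompleteModules.
Variables (E : fieldType) (V : lmodType (fps E)).
Implicit Types (A B S : set V) (s t : seq V) (x y z w : V).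
Local Notation X := (fpsX : fps E).

Lemma Xscale_submodule A n : submodule A -> submodule [set y | A (X ^+ n *: y)].
Proof.
move=> subA; split=> [|c y z /= Ay Az]; first by rewrite /= scaler0; exact: submodule0.
rewrite scalerDr scalerA mulrC -scalerA; exact: subA.2.
Qed.

Lemma uniform_torsion A t : submodule A ->
    (forall y, lspan t y -> exists n, A (X ^+ n *: y)) ->
  exists n, forall y, lspan t y -> A (X ^+ n *: y).
Proof.
move=> subA tA; have [x m n mn|x xt|c cP] :=
    @exists_uniform_bound _ t (fun x n => A (X ^+ n *: x)).
- by move=> Ax; rewrite -(subnK mn) exprD -scalerA; exact: submoduleZ.
- exact/tA/mem_lspan.
- by exists c; apply: lspan_sub => //; exact: Xscale_submodule.
Qed.

(** The elements that some power of X sends into [A] form a finitely generated submodule, so a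
    single X^c works for all of them. In particular X^c w lies in [A] and serves as [v]. *)
Lemma artin_rees s A : setT `<=` lspan s -> submodule A ->
  exists c, forall n w, A (X ^+ (n + c) *: w) ->
    exists2 v, A v & X ^+ (n + c) *: w = X ^+ n *: v.
Proof.
move=> sV subA; pose P := [set y | exists n, A (X ^+ n *: y)].
have [|t PE] := @submodule_fingen _ _ s P _ (fun y _ => sV y I).
  split=> [|f y z [m my] [n nz]]; first by exists 0%N; rewrite scaler0; exact: submodule0.
  exists (m + n)%N; rewrite scalerDr; apply: submoduleD => //.
    by rewrite scalerA mulrC exprD [X ^+ m * _]mulrC mulrA -scalerA; exact: submoduleZ.
  by rewrite exprD -scalerA; exact: submoduleZ.
have [y|c cP] := @uniform_torsion A t subA; first by rewrite -PE.
exists c => n w Aw; exists (X ^+ c *: w); last by rewrite scalerA exprD.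
by apply: cP; rewrite -PE; exists (n + c)%N.
Qed.

(** In the relation for the first generator [x], the coefficient 1 - X c is a unit. Solving for [x]
    and substituting gives relations of the same kind among the remaining generators. *)
Lemma nakayama S t : submodule S ->
    (forall y, lspan t y -> exists z w, [/\ S z, lspan t w & y = z + X *: w]) ->
  lspan t `<=` S.
Proof.
move=> subS; elim: t => [|x t IHt] tS; first by move=> y /= ->; exact: submodule0.
have subt := lspan_submodule t.
have [u [z [w [Sz tw xE]]]] : exists u z w, [/\ S z, lspan t w & x = u *: (z + X *: w)].
  have [z [_ [Sz [c [w [tw ->]]] xE]]] := tS x (mem_lspan (mem_head _ _)).
  have [u uE] := fps_geom c; exists u, z, w; split=> //.
  have -> : z + X *: w = (1 - X * c) *: x.
    by rewrite scalerBl scale1r {1}xE scalerDr scalerA addrA addrAC addrK.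
  by rewrite scalerA uE scale1r.
have tSub : lspan t `<=` S.
  apply: IHt => y ty.
  have [|z' [_ [Sz' [c [v [tv ->]]] yE]]] := tS y.
    by exists 0, y; rewrite scale0r add0r.
  exists (z' + (X * c * u) *: z), (v + (X * c * u) *: w); split.
  - by apply: submoduleD => //; exact: submoduleZ.
  - by apply: submoduleD => //; exact: submoduleZ.
  rewrite yE -addrA xE !scalerDr !scalerA; congr (_ + _).
  by rewrite -addrA [_ + X *: v]addrC [X * c * u * X]mulrC.
move=> _ [c [v [/tSub Sv ->]]]; apply: subS.2 => //.
rewrite xE; apply: submoduleZ => //; apply: submoduleD => //.
by apply: submoduleZ => //; exact: tSub.
Qed.

(** The X-adic closure [P] of [S] is finitely generated, and Artin-Rees gives P = S + X P, so
    Nakayama applies. *)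
Lemma krull_closed s S : setT `<=` lspan s -> submodule S ->
  forall y, (forall n, exists2 z, S z & exists w, y = z + X ^+ n *: w) -> S y.
Proof.
move=> sV subS; pose P := [set y | forall n, exists2 z, S z & exists w, y = z + X ^+ n *: w].
have subP : submodule P.
  split=> [n|f y z yP zP n].
    by exists 0; [exact: submodule0|exists 0; rewrite scaler0 addr0].
  have [y' Sy' [v ->]] := yP n; have [z' Sz' [w ->]] := zP n.
  exists (f *: y' + z'); first exact: subS.2.
  by exists (f *: v + w); rewrite !scalerDr !scalerA [f * _]mulrC addrACA.
have SP : S `<=` P by move=> y Sy n; exists y => //; exists 0; rewrite scaler0 addr0.
have [t PE] := submodule_fingen subP (fun y _ => sV y I).
have [c cP] := artin_rees sV subP.
suff tS : lspan t `<=` S by move=> y yP; apply: tS; rewrite -PE.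
apply: nakayama => // y; rewrite -PE => Py.
have [z Sz [w yE]] := Py (1 + c)%N.
have [|v Pv vE] := cP 1%N w.
  rewrite (_ : _ *: _ = y - z); last by rewrite yE addrAC subrr add0r.
  by apply: (submoduleB subP) => //; exact: SP.
by exists z, v; split=> //; rewrite yE vE.
Qed.

(** A generating family of minimal length is a basis. A nontrivial relation can be divided by the
    largest power of X dividing all its coefficients, as there is no torsion; some coefficient
    becomes a unit, and its generator could be dropped. *)
Lemma torsion_free_basis s : setT `<=` lspan s ->
    (forall y, X *: y = 0 -> y = 0) ->
  exists (n : nat) (e : 'I_n -> V), forall y, exists! c : 'I_n -> fps E,
    y = \sum_i c i *: e i.
Proof.
move=> sV tfV.
have tfX n y : X ^+ n *: y = 0 -> y = 0.
  elim: n => [|n IHn]; first by rewrite expr0 scale1r.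
  by rewrite exprS -scalerA => /tfV.
pose gen n := exists e : 'I_n -> V, forall y, exists c : 'I_n -> fps E, y = \sum_i c i *: e i.
have exn : exists n, `[< gen n >].
  exists (size s); apply/asboolP; exists (fun i => s`_i) => y.
  by have /lspan_nthP := sV y I.
have /ex_minnP[n /asboolP[e eP] nmin] := exn.
exists n, e => y; have [c yE] := eP y; exists c; split=> // c' yE'.
apply: contrapT => cc'; pose d i := c i - c' i.
have dE : \sum_i d i *: e i = 0.
  by under eq_bigr do rewrite scalerBl; rewrite sumrB -yE -yE' subrr.
have /ex_minnP[v /asboolP[i0 di0] vmin] : exists v, `[< exists i, coefs (d i) v != 0 >].
  apply: contrapT => /forallNP h; apply: cc'; apply: funext => i.
  apply/eqP; rewrite -subr_eq0; apply/eqP/fpsP => v /=; rewrite if_same.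
  by apply/eqP; apply: contrapT => /negP dv; apply: (h v); apply/asboolP; exists i.
have dX i : exists g, d i = X ^+ v * g.
  apply: fps_Xn_dvd => j jv; apply/eqP; apply: contraTT jv => dj.
  by rewrite -leqNgt; apply: vmin; apply/asboolP; exists i.
have [g gE] := choice dX.
have geE : \sum_i g i *: e i = 0.
  by apply: (tfX v); rewrite scaler_sumr -[RHS]dE; apply: eq_bigr => i _; rewrite scalerA gE.
have [u uE] : exists u, u * g i0 = 1.
  by apply: fps_unit; move: di0; rewrite gE coefs_XnM ltnn subnn.
case: n => [|n] in e eP nmin c c' yE yE' cc' d dE vmin i0 di0 dX g gE geE uE *.
  by case: i0 {di0 uE}.
have : (n.+1 <= n)%N; last by rewrite ltnn.
apply: nmin; apply/asboolP; exists (e \o lift i0) => z; have [b ->] := eP z.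
exists (fun j => b (lift i0 j) - b i0 * u * g (lift i0 j)).
under [RHS]eq_bigr do rewrite scalerBl -scalerA.
rewrite sumrB -scaler_sumr (bigD1_ord i0) //=.
move: geE; rewrite (bigD1_ord i0) //= => /eqP; rewrite addrC addr_eq0 => /eqP ->.
by rewrite scalerN opprK scalerA -mulrA uE mulr1 addrC.
Qed.

End CompleteModules.

(** * Subquotients of modules *)

Section Subquotient.
Variables (R : comNzRingType) (V : lmodType R) (A B : set V).
Implicit Types y z : V.

(** The chosen point of the set y + B depends on that set only, so congruent elements get equal
    representatives. *)
Definition coset_repr y : V := xget 0 [set z | B (y - z)].

(** A / B is modelled by the chosen representatives lying in [A]. The proofs are parameters of the
    type so that its module structure can be inferred from it. *)
Definition subquot (subA : submodule A) (subB : submodule B) (BA : B `<=` A) : Type :=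
  {y : V | `[< A y /\ coset_repr y = y >]}.

Hypotheses (subA : submodule A) (subB : submodule B) (BA : B `<=` A).
Local Notation Q := (subquot subA subB BA).

HB.instance Definition _ := Choice.on Q.

Let reprP y : B (y - coset_repr y).
Proof.
rewrite /coset_repr; case: xgetP => [z _ //|/(_ y)]; case; rewrite /= subrr.
exact: submodule0.
Qed.

Let repr_eq y z : B (y - z) -> coset_repr y = coset_repr z.
Proof.
move=> yz; rewrite /coset_repr; congr xget; apply/seteqP; split=> x /= h.
  by rewrite -(subrK y z) -addrA; apply: submoduleD => //; rewrite -opprB; exact: submoduleN.
by rewrite -(subrK z y) -addrA; exact: submoduleD.
Qed.

Definition sqval (q : Q) : V := sval q.

Lemma sqval_in q : A (sqval q).
Proof. by case: q => y /= /asboolP[]. Qed.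

Fact sqproj_subproof y : A y ->
  `[< A (coset_repr y) /\ coset_repr (coset_repr y) = coset_repr y >].
Proof.
move=> Ay; apply/asboolP; split; last by rewrite -(repr_eq (reprP y)).
rewrite -[coset_repr y](subKr y); apply: submoduleB => //; exact: BA.
Qed.

(** For [y] outside [A] the value is junk. *)
Definition sqproj y : Q :=
  let sub z := is_true `[< A z /\ coset_repr z = z >] in
  if pselect (A y) is left Ay then exist sub _ (sqproj_subproof Ay)
  else exist sub _ (sqproj_subproof (submodule0 subA)).

Lemma sqvalK q : sqproj (sqval q) = q.
Proof.
apply: val_inj; rewrite /sqproj; case: pselect => [?|/(_ (sqval_in q))//] /=.
by have /asboolP[] := svalP q.
Qed.

Lemma sqprojK y : A y -> B (sqval (sqproj y) - y).
Proof.
move=> Ay; rewrite /sqproj; case: pselect => // ? /=.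
by rewrite /sqval /= -opprB; exact: submoduleN.
Qed.

Lemma sqproj_eq y z : A y -> A z -> sqproj y = sqproj z <-> B (y - z).
Proof.
move=> Ay Az; split=> [yz|/repr_eq yz]; last first.
  apply: val_inj; rewrite /sqproj; case: pselect => // ?; case: pselect => //.
rewrite -(subrKA (sqval (sqproj y))) {2}yz -opprB.
by apply: submoduleD => //; [apply: submoduleN => //|]; exact: sqprojK.
Qed.

Definition sq_add q r := sqproj (sqval q + sqval r).
Definition sq_opp q := sqproj (- sqval q).
Definition sq_scale c q := sqproj (c *: sqval q).

Let A0 := submodule0 subA.
Let AD := @submoduleD _ _ _ subA.
Let AZ := @submoduleZ _ _ _ subA.
Let AN := @submoduleN _ _ _ subA.

Let projD y z : A y -> A z -> sq_add (sqproj y) (sqproj z) = sqproj (y + z).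
Proof.
move=> Ay Az; apply/sqproj_eq; try exact: AD; first by apply: AD; exact: sqval_in.
by rewrite opprD addrACA; apply: submoduleD => //; exact: sqprojK.
Qed.

Let projZ c y : A y -> sq_scale c (sqproj y) = sqproj (c *: y).
Proof.
move=> Ay; apply/sqproj_eq; try exact: AZ; first by apply: AZ; exact: sqval_in.
by rewrite -scalerBr; apply: submoduleZ => //; exact: sqprojK.
Qed.

Let sqind (P : Q -> Prop) : (forall y, A y -> P (sqproj y)) -> forall q, P q.
Proof. by move=> h q; rewrite -(sqvalK q); apply: h; exact: sqval_in. Qed.

Fact sq_addA : associative sq_add.
Proof.
elim/sqind=> x Ax; elim/sqind=> y Ay; elim/sqind=> z Az.
by rewrite !projD ?addrA //; exact: AD.
Qed.
Fact sq_addC : commutative sq_add.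
Proof. by move=> q r; rewrite /sq_add addrC. Qed.
Fact sq_add0 : left_id (sqproj 0) sq_add.
Proof. by elim/sqind=> y Ay; rewrite projD ?add0r. Qed.
Fact sq_addN : left_inverse (sqproj 0) sq_opp sq_add.
Proof.
move=> q; rewrite -{2}(sqvalK q) /sq_opp projD ?addNr //; last exact: sqval_in.
by apply: AN; exact: sqval_in.
Qed.

HB.instance Definition _ := GRing.isZmodule.Build Q sq_addA sq_addC sq_add0 sq_addN.

Fact sq_scaleA a b q : sq_scale a (sq_scale b q) = sq_scale (a * b) q.
Proof. by elim/sqind: q => y Ay; rewrite !projZ ?scalerA //; exact: AZ. Qed.
Fact sq_scale1 : left_id 1 sq_scale.
Proof. by elim/sqind=> y Ay; rewrite projZ // scale1r. Qed.
Fact sq_scaleDr : right_distributive sq_scale +%R.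
Proof.
move=> c; elim/sqind=> y Ay; elim/sqind=> z Az.
transitivity (sq_scale c (sq_add (sqproj y) (sqproj z))); first by [].
transitivity (sq_add (sq_scale c (sqproj y)) (sq_scale c (sqproj z))); last by [].
rewrite (projD Ay Az) (projZ c Ay) (projZ c Az) projZ; last exact: AD.
by rewrite scalerDr projD //; exact: AZ.
Qed.
Fact sq_scaleDl q : {morph sq_scale^~ q : a b / a + b}.
Proof.
elim/sqind: q => y Ay a b.
transitivity (sq_add (sq_scale a (sqproj y)) (sq_scale b (sqproj y))); last by [].
by rewrite !projZ // projD ?scalerDl //; exact: AZ.
Qed.

HB.instance Definition _ := GRing.Zmodule_isLmodule.Build R Q
  sq_scaleA sq_scale1 sq_scaleDr sq_scaleDl.

Lemma sqprojD y z : A y -> A z -> sqproj (y + z) = sqproj y + sqproj z.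
Proof. by move=> Ay Az; rewrite -projD. Qed.

Lemma sqprojZ c y : A y -> sqproj (c *: y) = c *: sqproj y.
Proof. by move=> Ay; rewrite -projZ. Qed.

Lemma sqproj0 : sqproj 0 = 0. Proof. by []. Qed.

Lemma sqproj_eq0 y : A y -> sqproj y = 0 <-> B y.
Proof. by move=> Ay; rewrite -sqproj0 -{2}[y]subr0; exact: sqproj_eq. Qed.

Lemma sqproj_ind (P : Q -> Prop) : (forall y, A y -> P (sqproj y)) -> forall q, P q.
Proof. exact: sqind. Qed.

End Subquotient.

(** * Nilpotency of psi *)

Section PsiGamma.
Variables (p : nat) (p_pr : prime p) (E : fieldType) (M : psiGamma p_pr E).
Implicit Types (y z w : M) (f g c : fps E) (A B S L : set M).
Local Notation X := (fpsX : fps E).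
Local Notation Zp := (padic_int p_pr).

Lemma iter_psiD k : {morph iter k (@psi _ _ _ M) : y z / y + z}.
Proof. by elim: k => [|k IHk] y z //=; rewrite IHk psiD. Qed.

Lemma iter_psi0 k : iter k psi (0 : M) = 0.
Proof. by apply: (addrI (iter k psi 0)); rewrite -iter_psiD !addr0. Qed.

Lemma iter_psiB k y z : iter k psi (y - z) = iter k psi y - iter k psi z.
Proof. by apply/eqP; rewrite eq_sym subr_eq -iter_psiD subrK. Qed.

Lemma psi0 : psi (0 : M) = 0. Proof. exact: (iter_psi0 1). Qed.

Lemma psi_XpnM n y : psi (X ^+ (p * n) *: y) = X ^+ n *: psi y.
Proof. by rewrite -fps_comp_XnXp ?prime_gt0 // psiZ. Qed.

Lemma iter_psi_XnM k n y :
  iter k psi (X ^+ (p ^ k * n) *: y) = X ^+ n *: iter k psi y.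
Proof.
elim: k n => [|k IHk] n /=; first by rewrite mul1n.
by rewrite expnSr -mulnA IHk psi_XpnM.
Qed.

(** The witness is f(X^(p^k)). Hence psi^k maps submodules to submodules, although it is not linear
    over power series. *)
Lemma iter_psi_scale k f : exists g, forall y,
  f *: iter k psi y = iter k psi (g *: y).
Proof.
elim: k f => [|k IHk] f; first by exists f.
have [g gE] := IHk (fps_comp f (fpsX ^+ p)).
by exists g => y; rewrite /= -psiZ gE.
Qed.

Lemma psi_scaleC (c : E) y : psi (fpsC c *: y) = fpsC c *: psi y.
Proof. by rewrite -psiZ fps_compC. Qed.

(** Applying [a][a^-1] to the left side reduces this to the semilinearity of [a^-1], without
    composing substitutions of series. *)
Lemma scale_gam (a : Zp) f y : a \is a GRing.unit ->
  f *: gam a y = gam a (fps_gam a^-1 f *: y).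
Proof.
move=> ua; have uaV : a^-1 \is a GRing.unit by rewrite unitrV.
rewrite -[LHS]gam1 -{1}(divrr ua) gamM // gamZ //.
by rewrite -gamM // mulVr // gam1.
Qed.

Lemma gam_Xn_dvd (a : Zp) n y : a \is a GRing.unit ->
  exists w, gam a (X ^+ n *: y) = X ^+ n *: w.
Proof.
move=> ua; rewrite gamZ // /fps_gam.
have [g ->] := fps_comp_Xn_dvd n (fps_onePX E a - 1).
by exists (g *: gam a y); rewrite scalerA.
Qed.

Lemma sub_psiGamma_submodule A : sub_psiGamma A -> submodule A.
Proof. by case=> A0 AD AZ _ _; split=> // c y z Ay Az; apply: AD => //; exact: AZ. Qed.

Lemma sub_iter_psi A k y : (forall y, A y -> A (psi y)) -> A y -> A (iter k psi y).
Proof. by move=> Apsi Ay; elim: k => //= k; exact: Apsi. Qed.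

Lemma pg_lspan : exists s : seq M, setT `<=` lspan s.
Proof.
have [n [e eP]] := pg_fingen M; exists (map e (enum 'I_n)) => y _.
by have [c ->] := eP y; rewrite -big_enum; exact: lspan_imageP.
Qed.

Lemma limpsi_iter (y : zseq M) k i : limpsi y -> iter k psi (y (i + k%:Z)) = y i.
Proof.
move=> yP; elim: k i => [|k IHk] i; first by rewrite addr0.
by rewrite -[k.+1]addn1 PoszD addrA iterD /= yP IHk.
Qed.

(** Components of nonnegative index are iterated choices of preimages in [L]. Those of negative
    index are iterates of [psi], which may leave [L] but stay in any psi-stable [S] around it. *)
Lemma limpsi_lift L y : (forall y, L y -> exists2 z, L z & psi z = y) -> L y ->
  exists2 u : zseq M, limpsi u & u 0 = y /\
    forall S, L `<=` S -> (forall y, S y -> S (psi y)) -> forall i, S (u i).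
Proof.
move=> Lpsi Ly; have /choice[h hP] : forall z, exists w, L z -> L w /\ psi w = z.
  move=> z; have [/Lpsi[w Lw wz]|nLz] := pselect (L z); first by exists w.
  by exists 0.
have Lh n : L (iter n h y) by elim: n => // n /hP[].
exists (fun i => match i with Posz n => iter n h y | Negz n => iter n.+1 psi y end).
  case=> [n|[|n]] //.
    by rewrite -PoszD addn1 /=; exact: (hP _ (Lh n)).2.
  by rewrite (_ : Negz n.+1 + 1 = Negz n) //; lia.
split=> // S LS Spsi [n|n]; first exact/LS/Lh.
by apply: (sub_iter_psi n.+1 Spsi); exact: LS.
Qed.

Let iter_psi_submodule S k : submodule S ->
  submodule [set z | exists2 y, S y & z = iter k psi y].
Proof.
move=> subS; split.
  by exists 0; [exact: submodule0|rewrite iter_psi0].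
move=> c _ _ [y Sy ->] [z Sz ->]; have [g gE] := iter_psi_scale k c.
by exists (g *: y + z); [exact: subS.2|rewrite iter_psiD -gE].
Qed.

(** [psi] contracts [X]-adic exponents by [p], so as soon as [X^a A] lies in
    [psi A] the lattice [X^(pa) A] lies in its own image under [psi]. *)
Lemma psi_nilpotent_or_limpsi S : submodule S -> (forall y, S y -> S (psi y)) ->
  (exists k, forall y, S y -> iter k psi y = 0) \/
  exists2 u : zseq M, limpsi u & u <> 0 /\ forall i, S (u i).
Proof.
move=> subS Spsi; have [[u uP uS]|nolim] :=
    pselect (exists2 u : zseq M, limpsi u & u <> 0 /\ forall i, S (u i)).
  by right; exists u.
left.
(* A subset of [S] contained in its own image under [psi] is zero, since a nonzero element would
   lift to a nonzero sequence in [S]. *)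
have noL L : L `<=` S -> (forall y, L y -> exists2 z, L z & psi z = y) ->
    forall y, L y -> y = 0.
  move=> LS Lpsi y Ly; apply: contrapT => y0; apply: nolim.
  have [u uP [u0 uS]] := limpsi_lift Lpsi Ly; exists u => //; split; last exact: uS.
  by move=> uE; apply: y0; rewrite -u0 uE.
have [s sM] := pg_lspan.
pose A k := [set z | exists2 y, S y & z = iter k psi y].
have subA k : submodule (A k) by exact: iter_psi_submodule.
have decA k : A k.+1 `<=` A k.
  by move=> _ [y Sy ->]; exists (psi y); rewrite ?iterSr //; exact: Spsi.
(* The rank of psi^k S stabilises at [k0]: a power of X carries each element of [A k0] into
   [A k0.+1], and finite generation makes the exponent [a] uniform. *)
have [||||k0 k0P] := @chain_stable _ _ [set f | exists n, f = X ^+ n] s A _ _ _ subA decA.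
- by exists 0%N.
- by move=> _ _ [m ->] [n ->]; exists (m + n)%N; rewrite exprD.
- move=> c; have [->|/fps_valP[v [g [_ [gE _]]]]] := eqVneq c 0.
    by right=> x _; rewrite scale0r.
  by left; exists g, v.
- by move=> y _; exact: sM.
have [t tE] := submodule_fingen (subA k0) (fun y _ => sM y I).
have [y|a aP] := uniform_torsion (subA k0.+1) (t := t).
  by rewrite -tE => /(k0P _ (leqnSn _))[_ [n ->]]; exists n.
rewrite -tE in aP.
(* For L = X^(pa) psi^k0 S, split p a = a + a + (p-2) a, possible as p >= 2. One X^a moves the
   element into psi^(k0+1) S, the other comes from psi(X^(pa) y) = X^a psi y; so [L] lies in psi L
   and is zero. *)
have XA0 y : A k0 y -> X ^+ (p * a) *: y = 0.
  move=> Ay; apply: (noL [set z | exists2 y, A k0 y & z = X ^+ (p * a) *: y]); last by exists y.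
    move=> _ [_ [z Sz ->] ->]; apply: submoduleZ => //; exact: sub_iter_psi.
  move=> _ [z Az ->].
  have pE : (p * a = a + (a + (p - 2) * a))%N.
    by rewrite addnA addnn -mul2n -mulnDl subnKC ?prime_gt1.
  have [|w Sw wE] := aP (X ^+ ((p - 2) * a) *: z); first exact: submoduleZ.
  exists (X ^+ (p * a) *: iter k0 psi w).
    by exists (iter k0 psi w) => //; exists w.
  by rewrite psi_XpnM -iterS -wE scalerA scalerA -!exprD -addnA -pE.
(* On the kernel [T] of X in [S], power series act through their constant terms, so the chain psi^k
   T itself becomes stationary; its stable value lies in its own image and is zero. *)
pose T := S `&` [set y | X *: y = 0].
have subT : submodule T by apply: setI_submodule => //; exact: ker_submodule.
have Tpsi y : T y -> T (psi y).
  case=> Sy Xy; split; first exact: Spsi.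
  have XpE : X ^+ p *: y = X ^+ p.-1 *: (X *: y).
    by rewrite scalerA -exprSr prednK ?prime_gt0.
  by rewrite /= -[X]expr1 -psi_XpnM muln1 XpE Xy scaler0 psi0.
have [t' TE] := submodule_fingen subT (fun y _ => sM y I).
pose C k := [set z | exists2 y, T y & z = iter k psi y].
have [||||||k1 k1P] := @chain_stable _ _ [set 1] t' C.
- by [].
- by move=> _ _ -> ->; rewrite /= mulr1.
- move=> c; have [[g gc]|[g ->]] := fps_unit_or_X c; first by left; exists g.
  right=> x /mem_lspan; rewrite -TE => -[_ /= Xx].
  by rewrite mulrC -scalerA Xx scaler0.
- by move=> k; exact: iter_psi_submodule.
- by move=> k _ [y Ty ->]; exists (psi y); rewrite ?iterSr //; exact: Tpsi.
- by move=> _ [y Ty ->]; rewrite -TE.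
have C0 y : C k1 y -> y = 0.
  apply: noL => [_ [z [Sz _] ->]|z Cz]; first exact: sub_iter_psi.
  have [_ -> [w Tw zE]] := k1P _ (leqnSn _) z Cz.
  by exists (iter k1 psi w); [exists w|rewrite -iterS -zE scale1r].
(* After psi^k0 the element is killed by X^(pa), hence by X^(p^(pa)), which psi^(pa) contracts to X.
   So psi^(pa + k0) y lies in [T], where psi^k1 vanishes. *)
exists (k1 + (p * a + k0))%N => y Sy; apply: C0.
exists (iter (p * a + k0) psi y); last by rewrite iterD.
split; first exact: sub_iter_psi.
have le : (p * a <= p ^ (p * a))%N by rewrite ltnW // ltn_expl ?prime_gt1.
rewrite /= iterD -[X]expr1 -iter_psi_XnM muln1 -(subnK le) exprD -scalerA.
by rewrite XA0 ?scaler0 ?iter_psi0 //; exists y.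
Qed.
End PsiGamma.

(** * Topologies *)

(** Stated in terms of residues and multiples of powers of X, continuity can be passed through the
    projection to a subquotient. *)
Lemma xadic_continuousP (p : nat) (p_pr : prime p) (E : fieldType)
    (V : lmodType (fps E)) (h : padic_int p_pr -> V -> V) :
  {within [set ay : padic_int p_pr * xadic V | ay.1 \is a GRing.unit],
     continuous (fun ay => h ay.1 ay.2 : xadic V)} <->
  forall a y n, a \is a GRing.unit -> exists r s, forall b w,
    b \is a GRing.unit -> res b r = res a r ->
    exists v, h b (y + fpsX ^+ s *: w) = h a y + fpsX ^+ n *: v.
Proof.
rewrite subspace_continuousP; split=> [hc a y n ua|hc [a y] /= ua W [n _ nW]].
  have /(_ [set z | exists w : V, z = h a y + (fpsX ^+ n : fps E) *: w]) := hc (a, y) ua.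
  case=> [|[U1 U2] /= [[r _ rU1] [s _ sU2]] U12]; first by exists n.
  exists r, s => b w ub ba; apply: (U12 (b, y + fpsX ^+ s *: w)) => //.
  by split=> /=; [exact: rU1|apply: sU2; exists w].
have [r [s rsP]] := hc a y n ua.
exists ([set b | res b r = res a r],
  [set z | exists w : V, z = y + (fpsX ^+ s : fps E) *: w]) => /=.
  by split; [exists r|exists s].
case=> b z [/= ba [w ->]] ub; apply: nW => /=; exact: rsP.
Qed.

Section ZseqTopology.
Variables (p : nat) (p_pr : prime p) (E : fieldType).
Implicit Types (M N : psiGamma p_pr E).
Local Notation X := (fpsX : fps E).

(** These are the basic neighbourhoods of [y] in the product of the X-adic topologies: precision [n]
    on a finite window of indices. *)
Definition zclose M k n (y z : zseq M) :=
  forall i : int, (`|i| <= k)%N -> exists w : M, z i = y i + X ^+ n *: w.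

Lemma zseq_cvgP M (F : set_system (zseq M)) (y : zseq M) : Filter F ->
  F --> y <-> forall i, (fun z : zseq M => z i) @ F --> y i.
Proof.
move=> FF; rewrite (@cvg_sup _ _ _ F y FF).
split=> h i; have := h i;
  (rewrite cvg_image; last by rewrite eqEsubset; split=> v // _; exists (fun=> v)).
  apply: cvg_trans => W /= [W' FW' <-].
  by apply: (@filterS _ F _ W') FW' => z W'z; exists z.
move=> zi W /zi WF; exists [set z : zseq M | W (z i)] => //.
by rewrite eqEsubset; split=> [_ [z ? <-]//|v Wv]; exists (fun=> v).
Qed.

(** In one direction finitely many coordinate conditions are intersected. In the other, the filter
    [F] generated by the [zclose] sets converges to [y] coordinatewise, so it contains every
    neighbourhood of [y]. *)
Lemma zseq_nbhsP M (y : zseq M) (W : set (zseq M)) :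
  nbhs y W <-> exists k n, zclose k n y `<=` W.
Proof.
split; last first.
  move=> [k [n knW]]; apply: filterS knW _.
  have coord i : nbhs y [set z : zseq M | exists w : M, z i = y i + X ^+ n *: w].
    have /zseq_cvgP/(_ i) yi : nbhs y --> y by [].
    by apply: (yi [set u | exists w : M, u = y i + X ^+ n *: w]); exists n.
  have fin (s : seq int) : nbhs y
      [set z : zseq M | forall i, i \in s -> exists w : M, z i = y i + X ^+ n *: w].
    elim: s => [|j s IHs]; first by apply: filterS filterT => z _ i.
    apply: filterS (filterI (coord j) IHs) => z [zj zs] i.
    by rewrite inE => /orP[/eqP ->|/zs].
  apply: filterS (fin ([seq j%:Z | j <- iota 0 k.+1] ++ [seq - j%:Z | j <- iota 0 k.+1])).
  move=> z zP i ik; apply: zP; rewrite mem_cat; apply/orP.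
  have [i0|i0] := lerP 0 i; [left|right]; apply/mapP; exists `|i|%N;
    by rewrite ?mem_iota //; lia.
pose F := filter_from [set: nat * nat] (fun kn => zclose kn.1 kn.2 y).
have FF : Filter F.
  apply: filter_from_filter; first by exists (0, 0)%N.
  move=> [k m] [l n] _ _; exists (maxn k l, m + n)%N => // z zP; split=> i ik.
    have [|w ->] := zP i; first by rewrite /= leq_max ik.
    by exists (X ^+ n *: w); rewrite scalerA -exprD.
  have [|w ->] := zP i; first by rewrite /= leq_max ik orbT.
  by exists (X ^+ m *: w); rewrite scalerA -exprD addnC.
have : F --> y.
  apply/zseq_cvgP => i B [n _ nB]; exists (`|i|%N, n) => // z zP.
  by apply: nB; exact: zP.
by move=> Fy /Fy[[k n] _ knW]; exists k, n.
Qed.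

Lemma closed_zseqP M (U : set (zseq M)) :
  closed U <-> forall y, (forall k n, exists2 z, U z & zclose k n y z) -> U y.
Proof.
split=> [cU y yU|yU y Uy].
  apply: cU => W /zseq_nbhsP[k [n knW]]; have [z Uz yz] := yU k n.
  by exists z; split=> //; exact: knW.
apply: yU => k n; have [|z [Uz yz]] := Uy (zclose k n y); last by exists z.
by apply/zseq_nbhsP; exists k, n.
Qed.

Lemma zseq_continuous M N (V : set (zseq M)) (f : zseq M -> zseq N) :
    (forall y i n, V y -> exists k m, forall z, V z -> zclose k m y z ->
       exists w : N, f z i = f y i + X ^+ n *: w) ->
  {within V, continuous f}.
Proof.
move=> fP; apply/subspace_continuousP => y Vy; apply/zseq_cvgP => i B [n _ nB].
have [k [m kmP]] := fP y i n Vy.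
suff : nbhs y [set z : zseq M | V z -> B (f z i)] by [].
by apply/zseq_nbhsP; exists k, m => z yz Vz; apply: nB; exact: kmP.
Qed.

End ZseqTopology.

(** * Subquotients of (psi, Gamma)-modules *)

Lemma sqproj_sum (R : comNzRingType) (V : lmodType R) (A B : set V)
    (subA : submodule A) (subB : submodule B) (BA : B `<=` A)
    (I : Type) (r : seq I) (F : I -> V) : (forall i, A (F i)) ->
  sqproj subA subB BA (\sum_(i <- r) F i) = \sum_(i <- r) sqproj subA subB BA (F i).
Proof.
move=> AF; elim: r => [|i r IHr]; first by rewrite !big_nil.
by rewrite !big_cons sqprojD ?IHr //; exact: submodule_sum.
Qed.

Section SubquotientPsiGamma.
Variables (p : nat) (p_pr : prime p) (E : fieldType) (M : psiGamma p_pr E).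
Variables (A B : set M) (sA : sub_psiGamma A) (sB : sub_psiGamma B) (BA : B `<=` A).
Local Notation X := (fpsX : fps E).

Let subA := sub_psiGamma_submodule sA.
Let subB := sub_psiGamma_submodule sB.
Local Notation Q := (subquot subA subB BA).
Local Notation pi := (sqproj subA subB BA).

Let Apsi : forall y, A y -> A (psi y). Proof. by case: sA. Qed.
Let Bpsi : forall y, B y -> B (psi y). Proof. by case: sB. Qed.
Let Agam : forall a y, a \is a GRing.unit -> A y -> A (gam a y). Proof. by case: sA. Qed.
Let Bgam : forall a y, a \is a GRing.unit -> B y -> B (gam a y). Proof. by case: sB. Qed.

Definition sq_psi (q : Q) : Q := pi (psi (sqval q)).
Definition sq_gam a (q : Q) : Q := pi (gam a (sqval q)).

Lemma gamB a (y z : M) : a \is a GRing.unit -> gam a (y - z) = gam a y - gam a z.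
Proof. by move=> ua; apply/eqP; rewrite eq_sym subr_eq -gamD // subrK. Qed.

Lemma sq_psiE y : A y -> sq_psi (pi y) = pi (psi y).
Proof.
move=> Ay; apply/sqproj_eq; first exact/Apsi/sqval_in; first exact: Apsi.
by rewrite -(iter_psiB 1); apply: Bpsi; exact: sqprojK.
Qed.

Lemma sq_gamE a y : a \is a GRing.unit -> A y -> sq_gam a (pi y) = pi (gam a y).
Proof.
move=> ua Ay; apply/sqproj_eq; first exact/Agam/sqval_in; first exact: Agam.
by rewrite -gamB //; apply: Bgam => //; exact: sqprojK.
Qed.

Fact sq_fingen : exists (n : nat) (e : 'I_n -> Q),
  forall y, exists c : 'I_n -> fps E, y = \sum_i c i *: e i.
Proof.
have [s sM] := pg_lspan M.
have [t tE] := submodule_fingen subA (fun y _ => sM y I).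
have At (i : 'I_(size t)) : A t`_i by rewrite tE; apply: mem_lspan; exact: mem_nth.
exists (size t), (fun i => pi t`_i) => q.
have [|c qE] := @lspan_nthP _ _ t (sqval q); first by rewrite -tE; exact: sqval_in.
exists c; rewrite -[LHS]sqvalK qE sqproj_sum => [|i]; last exact: submoduleZ.
by apply: eq_bigr => i _; rewrite sqprojZ.
Qed.

Fact sq_psiD : {morph sq_psi : y z / y + z}.
Proof.
elim/sqproj_ind=> y Ay; elim/sqproj_ind=> z Az.
rewrite -sqprojD // !sq_psiE //; last exact: submoduleD.
by rewrite psiD sqprojD //; exact: Apsi.
Qed.

Fact sq_psiZ f q : sq_psi (fps_comp f (fpsX ^+ p) *: q) = f *: sq_psi q.
Proof.
elim/sqproj_ind: q => y Ay; rewrite -sqprojZ // !sq_psiE //; last exact: submoduleZ.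
by rewrite psiZ sqprojZ //; exact: Apsi.
Qed.

Fact sq_gamD a : a \is a GRing.unit -> {morph sq_gam a : y z / y + z}.
Proof.
move=> ua; elim/sqproj_ind=> y Ay; elim/sqproj_ind=> z Az.
rewrite -sqprojD // !sq_gamE //; last exact: submoduleD.
by rewrite gamD // sqprojD //; exact: Agam.
Qed.

Fact sq_gamZ a f q : a \is a GRing.unit ->
  sq_gam a (f *: q) = fps_gam a f *: sq_gam a q.
Proof.
move=> ua; elim/sqproj_ind: q => y Ay.
rewrite -sqprojZ // !sq_gamE //; last exact: submoduleZ.
by rewrite gamZ // sqprojZ //; exact: Agam.
Qed.

Fact sq_gam1 q : sq_gam 1 q = q.
Proof. by elim/sqproj_ind: q => y Ay; rewrite sq_gamE ?gam1 // unitr1. Qed.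

Fact sq_gamM a b q : a \is a GRing.unit -> b \is a GRing.unit ->
  sq_gam (a * b) q = sq_gam a (sq_gam b q).
Proof.
move=> ua ub; elim/sqproj_ind: q => y Ay.
by rewrite !sq_gamE ?gamM // ?unitrM ?ua //; exact: Agam.
Qed.

(** By Artin-Rees the [X]-adic topology of [A] is induced by that of [M]. *)
Lemma sqproj_close : exists c, forall n y z w, A y -> A z ->
  z = y + X ^+ (n + c) *: w -> exists q : Q, pi z = pi y + X ^+ n *: q.
Proof.
have [s sM] := pg_lspan M; have [c cP] := artin_rees sM subA.
exists c => n y z w Ay Az zE; have [|v Av vE] := cP n w.
  by rewrite (_ : _ *: w = z - y); [exact: submoduleB|rewrite zE addrAC subrr add0r].
by exists (pi v); rewrite zE vE sqprojD ?sqprojZ //; exact: submoduleZ.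
Qed.

(** Precision n + c in [M] gives precision [n] in the subquotient, [c] being the Artin-Rees constant
    of [A]. *)
Fact sq_gam_continuous :
  {within [set ay : padic_int p_pr * xadic Q | ay.1 \is a GRing.unit],
    continuous (fun ay => sq_gam ay.1 ay.2 : xadic Q)}.
Proof.
apply/xadic_continuousP => a q n ua; elim/sqproj_ind: q => y Ay.
have [c cP] := sqproj_close.
have /xadic_continuousP/(_ a y (n + c)%N ua)[r [s rsP]] := @gam_continuous _ _ _ M.
exists r, s => b q ub ba; elim/sqproj_ind: q => w Aw.
have Aw' : A (y + X ^+ s *: w) by apply: submoduleD => //; exact: submoduleZ.
rewrite -sqprojZ // -sqprojD //; last exact: submoduleZ.
rewrite !sq_gamE //; have [v vE] := rsP b w ub ba.
by apply: cP vE; exact: Agam.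
Qed.

Fact sq_psi_gam a q : a \is a GRing.unit -> sq_psi (sq_gam a q) = sq_gam a (sq_psi q).
Proof.
move=> ua; elim/sqproj_ind: q => y Ay.
by rewrite sq_gamE // !sq_psiE ?sq_gamE ?psi_gam //; [exact: Apsi|exact: Agam].
Qed.

Definition subquot_psiGamma : psiGamma p_pr E :=
  PsiGamma sq_fingen sq_psiD sq_psiZ sq_gamD sq_gamZ sq_gam1 sq_gamM
    sq_gam_continuous sq_psi_gam.

End SubquotientPsiGamma.

(** * Subquotients and the action of the Borel subgroup *)

Section SubquotientMaps.
Variables (p : nat) (p_pr : prime p) (E : fieldType) (M : psiGamma p_pr E).
Variables (A B : set M) (sA : sub_psiGamma A) (sB : sub_psiGamma B) (BA : B `<=` A).
Local Notation N := (subquot_psiGamma sA sB BA).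

(** This is [sqproj] retyped into the bundled (psi, Gamma)-module, so that [psi] and [gam] apply to
    its values; likewise [pgval] for [sqval]. *)
Definition pgproj (y : M) : N :=
  sqproj (sub_psiGamma_submodule sA) (sub_psiGamma_submodule sB) BA y.
Definition pgval (q : N) : M := sqval q.

Lemma pgproj_psi k y : A y -> iter k psi (pgproj y) = pgproj (iter k psi y).
Proof.
move=> Ay; have Apsi : forall y, A y -> A (psi y) by case: sA.
elim: k => //= k ->; apply: sq_psiE; exact: sub_iter_psi.
Qed.

Lemma pgproj_gam a y : a \is a GRing.unit -> A y -> gam a (pgproj y) = pgproj (gam a y).
Proof. by move=> ua Ay; exact: sq_gamE. Qed.

Lemma pgprojZ c y : A y -> pgproj (c *: y) = c *: pgproj y.
Proof. by move=> Ay; exact: sqprojZ. Qed.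

Lemma pgprojD y z : A y -> A z -> pgproj (y + z) = pgproj y + pgproj z.
Proof. by move=> Ay Az; exact: sqprojD. Qed.

Lemma pgproj_eq0 y : A y -> pgproj y = 0 <-> B y.
Proof. by move=> Ay; exact: sqproj_eq0. Qed.

Lemma pgproj_eq y z : A y -> A z -> pgproj y = pgproj z <-> B (y - z).
Proof. by move=> Ay; exact: sqproj_eq. Qed.

Lemma pgvalK q : pgproj (pgval q) = q. Proof. exact: sqvalK. Qed.

Lemma pgval_in q : A (pgval q). Proof. exact: sqval_in. Qed.

Lemma pgproj_close : exists c, forall n y z w, A y -> A z ->
  z = y + fpsX ^+ (n + c) *: w -> exists q : N, pgproj z = pgproj y + fpsX ^+ n *: q.
Proof. exact: sqproj_close. Qed.

End SubquotientMaps.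

(** * Submodules on which psi is nilpotent *)

Section PsiNil.
Variables (p : nat) (p_pr : prime p) (E : fieldType) (M : psiGamma p_pr E).

(** The kernel of psi^k is only stable under series in X^(p^k); quantifying over [f] selects the
    largest submodule inside it. *)
Definition psi_nil k : set M := [set y | forall f, iter k psi (f *: y) = 0].

Lemma psi_nil_submodule k : submodule (psi_nil k).
Proof.
split=> [f|c y z yk zk f]; first by rewrite scaler0 iter_psi0.
by rewrite scalerDr scalerA iter_psiD yk zk addr0.
Qed.

Lemma psi_nil_mon k l : (k <= l)%N -> psi_nil k `<=` psi_nil l.
Proof. by move=> kl y yk f; rewrite -(subnK kl) iterD yk iter_psi0. Qed.

(** The union of this increasing chain is a finitely generated submodule, so it is reached at a
    finite stage. *)
Lemma psi_nil_bound : exists m, forall k, psi_nil k `<=` psi_nil m.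
Proof.
have [s sM] := pg_lspan M.
have [|t tE] := @submodule_fingen _ _ s [set y | exists k, psi_nil k y] _ (fun y _ => sM y I).
  split; first by exists 0%N; exact: submodule0 (psi_nil_submodule 0).
  move=> c y z [k yk] [l zl]; exists (maxn k l).
  apply: (psi_nil_submodule _).2; first exact: psi_nil_mon (leq_maxl _ _) _ yk.
  exact: psi_nil_mon (leq_maxr _ _) _ zl.
have [x m n mn|x xt|m mP] := @exists_uniform_bound _ t (fun x n => psi_nil n x).
- exact: psi_nil_mon.
- by have : lspan t x by [exact: mem_lspan]; rewrite -tE.
exists m => k y yk; apply: (lspan_sub (psi_nil_submodule m) mP).
by rewrite -tE; exists k.
Qed.

End PsiNil.

(** * Limits of submodules as closed subrepresentations *)

Section Borel.
Variables (p : nat) (p_pr : prime p) (E : fieldType) (chE : p \in [pchar E]).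
Variables (chi : padic p_pr -> E).
Implicit Types (M N : psiGamma p_pr E).

Lemma sub_borel_act M (S : set M) g (y : zseq M) : sub_psiGamma S -> borel g ->
  (forall i, S (y i)) -> forall i, S (borel_act chi g y i).
Proof.
move=> [S0 SD SZ Spsi Sgam] /borelE[g00 g11 _] Sy i.
rewrite /borel_act /unip_act; apply: sub_iter_psi => //; apply: (SZ).
apply: SZ; apply: Sgam => //; rewrite unitrV.
have [|//] := @padic_valP _ p_pr (g 1 1 / g 0 0).
by rewrite mulf_neq0 ?invr_neq0.
Qed.

Lemma pgproj_borel_act M (A B : set M) (sA : sub_psiGamma A) (sB : sub_psiGamma B)
    (BA : B `<=` A) g (y : zseq M) : borel g -> (forall i, A (y i)) ->
  (fun i => pgproj sA sB BA (borel_act chi g y i)) =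
  borel_act chi g (fun i => pgproj sA sB BA (y i)).
Proof.
move=> /borelE[g00 g11 _] Ay; have [A0 AD AZ Apsi Agam] := sA.
have uV : (padic_ac (g 1 1 / g 0 0))^-1 \is a GRing.unit.
  rewrite unitrV; have [|//] := @padic_valP _ p_pr (g 1 1 / g 0 0).
  by rewrite mulf_neq0 ?invr_neq0.
apply: funext => i; rewrite /borel_act /unip_act -pgproj_psi.
  rewrite pgprojZ /central_act ?pgprojZ /diag_act ?pgproj_gam //.
    exact: Agam.
  by apply: (AZ); exact: Agam.
by apply: (AZ); apply: AZ; exact: Agam.
Qed.

Definition limsub M (S : set M) : set (zseq M) :=
  [set y | limpsi y /\ forall i, S (y i)].

(** Closedness holds because every submodule of a finitely generated module is X-adically closed. *)
Lemma limsub_closed_subrep M (S : set M) (W : set (zseq M)) :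
  sub_psiGamma S -> limsub S `<=` W -> W `<=` limpsi (M := M) ->
  closed_subrep chi W (limsub S).
Proof.
move=> sS SW WL; have [S0 SD SZ _ _] := sS.
split=> //.
- apply/closed_subspaceP; exists [set y : zseq M | forall i, S (y i)].
    apply/closed_zseqP => y yS i; have [s sM] := pg_lspan M.
    apply: (krull_closed sM (sub_psiGamma_submodule sS)) => n.
    have [z Sz /(_ i (leqnn _))[w zE]] := yS `|i|%N n.
    by exists (z i) => //; exists (- w); rewrite zE scalerN addrK.
  apply/seteqP; split=> y /= [h1 h2]; split=> //; last by case: h1.
  by split=> //; exact: WL.
- by split=> // i; exact: psi0.
- move=> c y z [yL yS] [zL zS]; split=> i; last by apply: SD => //; exact: SZ.
  by rewrite /= psiD psi_scaleC yL zL.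
- move=> g y bg [yL yS]; split; first exact: borel_act_limpsi.
  exact: sub_borel_act.
Qed.

(** With [n] of either sign, this makes subrepresentations stable under shifts in both
    directions. *)
Lemma borel_act_shift M (n : int) (y : zseq M) : chi 1 = 1 -> limpsi y ->
  borel_act chi (upper 1 0 (p%:R ^ n)) y = fun i => y (i - n).
Proof.
move=> chi1 yL; apply: funext => i.
rewrite /borel_act !mxE /= mul0r divr1.
set y' := central_act _ _ _.
have y'E : y' = fun i => y (i - n).
  apply: funext => j; rewrite /y' /central_act chi1 invr1 scale1r /diag_act.
  have [] := padic_val_eq n (unitr1 (padic_int p_pr)).
  by rewrite tofrac1 mulr1 => -> ->; rewrite invr1 gam1.
have y'L : limpsi y' by move=> j; rewrite y'E addrAC yL.
rewrite (@unip_actE _ _ _ chE _ 0 y' i 0 0) ?tofrac0 ?mulr0 //=.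
by rewrite fps_onePX0 scale1r addr0 y'E.
Qed.

Lemma upper_borel (a b d : padic p_pr) : a != 0 -> d != 0 -> borel (upper a b d).
Proof. by move=> a0 d0; apply/borelE; rewrite !mxE. Qed.

End Borel.

(** * Closed subrepresentations *)

Section Subrepresentation.
Variables (p : nat) (p_pr : prime p) (E : fieldType) (chE : p \in [pchar E]).
Variables (chi : padic p_pr -> E) (chi1 : chi 1 = 1).
Variables (M : psiGamma p_pr E) (Sigma : set (zseq M)).
Hypothesis Sigma_sub : closed_subrep chi (limpsi (M := M)) Sigma.
Local Notation X := (fpsX : fps E).

Definition pr0_closure : set M :=
  [set a | forall n, exists2 y, Sigma y & exists w, a = y 0 + X ^+ n *: w].

Let SL : Sigma `<=` limpsi (M := M). Proof. by case: Sigma_sub. Qed.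
Let SlinP : forall (c : E) y z, Sigma y -> Sigma z -> Sigma (fpsC c *: y + z).
Proof. by case: Sigma_sub. Qed.
Let S0 : Sigma 0. Proof. by case: Sigma_sub. Qed.
Let Sborel : forall g y, borel g -> Sigma y -> Sigma (borel_act chi g y).
Proof. by case: Sigma_sub. Qed.

Lemma Sigma_shift y (n : int) : Sigma y -> Sigma (fun i => y (i + n)).
Proof.
move=> Sy; have := @borel_act_shift _ _ _ chE chi M (- n) y chi1 (SL Sy).
rewrite opprK => <-; apply: Sborel => //; apply: upper_borel; first exact: oner_neq0.
by rewrite expfz_neq0 // padic_p_neq0F.
Qed.

Let SZ (c : E) y : Sigma y -> Sigma (fpsC c *: y).
Proof. by move=> Sy; rewrite -[_ *: y]addr0; exact: SlinP. Qed.

Let SD y z : Sigma y -> Sigma z -> Sigma (y + z).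
Proof. by move=> Sy Sz; rewrite -[y]scale1r; exact: SlinP. Qed.

(** On the component of index 0, the unipotent matrix with entry 1 multiplies by 1 + X; subtracting
    the identity leaves X. *)
Let S_onePX y : Sigma y -> exists2 z, Sigma z & z 0 = X *: y 0.
Proof.
move=> Sy; exists (fpsC (-1) *: y + borel_act chi (upper 1 1 1) y).
  by apply: SlinP => //; apply: Sborel => //; apply: upper_borel; exact: oner_neq0.
have -> : (fpsC (-1) *: y + borel_act chi (upper 1 1 1) y) 0 =
  fpsC (-1) *: y 0 + borel_act chi (upper 1 1 1) y 0 by [].
rewrite borel_act_unip //.
rewrite (@unip_actE _ _ _ chE _ 1 y 0 0 1) /=; [|exact: SL|by rewrite tofrac1 expr0z mulr1].
rewrite fps_onePX1 // addr0 -scalerDl; congr (_ *: _).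
have -> : fpsC (-1) = -1 :> fps E by apply/fpsP => -[|i] //=; rewrite oppr0.
by rewrite addrA addNr add0r.
Qed.

(** The constant term of [f] acts by linearity and the rest is X times a series, so [n] uses of
    [S_onePX] approximate f y_0 modulo X^n. *)
Let S_fps n (f : fps E) y : Sigma y ->
  exists2 z, Sigma z & exists w, f *: y 0 = z 0 + X ^+ n *: w.
Proof.
elim: n f y => [|n IHn] f y Sy.
  by exists 0 => //; exists (f *: y 0); rewrite expr0 scale1r add0r.
have [g fE] := fps_headE f; have [z Sz [w zE]] := IHn g y Sy.
have [z' Sz' z'E] := S_onePX Sz.
exists (fpsC (coefs f 0) *: y + z'); first exact: SlinP.
exists w; rewrite {1}fE scalerDl -scalerA zE scalerDr scalerA -exprS.
by rewrite -z'E addrA.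
Qed.

(** Scalars come from [S_fps], [psi] from the shift by -1, and [u] from the matrix diag(1, u^-1).
    For [psi] the approximation is taken modulo X^(pn), since [psi] divides exponents by p. *)
Lemma pr0_closure_sub : sub_psiGamma pr0_closure.
Proof.
split.
- by move=> n; exists 0 => //; exists 0; rewrite scaler0 addr0.
- move=> a b aP bP n; have [y Sy [v ->]] := aP n; have [z Sz [w ->]] := bP n.
  by exists (y + z); [exact: SD|exists (v + w); rewrite scalerDr addrACA].
- move=> f a aP n; have [y Sy [v ->]] := aP n; have [z Sz [w zE]] := S_fps n f Sy.
  exists z => //; exists (w + f *: v).
  by rewrite scalerDr zE scalerDr !scalerA mulrC addrA.
- move=> a aP n; have [y Sy [v ->]] := aP (p * n)%N.
  exists (fun i => y (i + -1)); first exact: Sigma_shift.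
  exists (psi v); rewrite psiD psi_XpnM; congr (_ + _).
  by rewrite -(SL Sy (0 + -1)) -addrA addNr addr0.
- move=> u a uu aP n; have [y Sy [v ->]] := aP n.
  exists (borel_act chi (upper 1 0 (tofrac u^-1)) y).
    apply: Sborel => //; apply: upper_borel; first exact: oner_neq0.
    by rewrite tofrac_eq0; apply: contraTneq uu => u0; rewrite -unitrV u0 unitr0.
  rewrite borel_act_unit ?unitrV //; last exact: SL.
  have [w wE] := gam_Xn_dvd n v uu; exists w.
  by rewrite gamD // wE invrK.
Qed.

Lemma SigmaE : Sigma = limsub pr0_closure.
Proof.
apply/seteqP; split=> [y Sy|y [yL yA]].
  split; first exact: SL.
  move=> i n; exists (fun j => y (j + i)); first exact: Sigma_shift.
  by exists 0; rewrite scaler0 addr0 add0r.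
have [_ /closed_subspaceP[U cU UE] _ _ _] := Sigma_sub.
suff Uy : U y by have [] : (Sigma `&` limpsi (M := M)) y by rewrite -UE.
apply: (iffLR (closed_zseqP U)) => // k n.
(* At most 2k applications of [psi] lead from index [k] to an index of the window, each dividing the
   exponent by p; so precision p^(2k) n at [k] gives precision [n] on the whole window. *)
have [s Ss [w sE]] := yA k%:Z (p ^ (k + k) * n)%N.
exists (fun i => s (i + - k%:Z)).
  have Ssh : Sigma (fun i => s (i + - k%:Z)) by exact: Sigma_shift.
  suff [] : (U `&` limpsi (M := M)) (fun i => s (i + - k%:Z)) by [].
  by rewrite UE; split=> //; exact: SL.
move=> i ik; have [j jE jk] : exists2 j : nat, i + j%:Z = k%:Z & (j <= k + k)%N.
  by exists `|k%:Z - i|%N; lia.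
have zL : limpsi (fun i => s (i + - k%:Z)) by apply: SL; exact: Sigma_shift.
exists (- (X ^+ (p ^ (k + k - j) * n - n) *: iter j psi w)).
rewrite -(limpsi_iter j i zL) -(limpsi_iter j i yL) jE sE iter_psiD subrr.
rewrite scalerN scalerA -exprD subnKC; last first.
  by rewrite leq_pmull // expn_gt0 prime_gt0.
by rewrite -iter_psi_XnM mulnA -expnD subnKC // addrK.
Qed.

End Subrepresentation.

(** * The kernel of X and modules killed by X *)

Section KilledByX.
Variables (p : nat) (p_pr : prime p) (E : fieldType) (M : psiGamma p_pr E).
Local Notation X := (fpsX : fps E).

(** Stability follows from X psi(y) = psi(X^p y) and from X dividing [a^-1]X. *)
Lemma ker_X_sub_psiGamma : sub_psiGamma [set y : M | X *: y = 0].
Proof.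
split.
- by rewrite /= scaler0.
- by move=> y z /= y0 z0; rewrite scalerDr y0 z0 addr0.
- by move=> f y /= y0; rewrite scalerA mulrC -scalerA y0 scaler0.
- move=> y /= y0; rewrite -[X]expr1 -psi_XpnM muln1.
  have -> : X ^+ p *: y = X ^+ p.-1 *: (X *: y).
    by rewrite scalerA -exprSr prednK ?prime_gt0.
  by rewrite y0 scaler0 psi0.
- move=> a y ua /= y0; rewrite scale_gam // /fps_gam -[X]expr1.
  have [g ->] := fps_comp_Xn_dvd 1 (fps_onePX E a^-1 - 1).
  by rewrite mulrC -scalerA expr1 y0 scaler0 -[0 in LHS](subrr 0) gamB // subrr.
Qed.

Hypothesis X0 : forall y : M, X *: y = 0.

Lemma scale_constE f (y : M) : f *: y = fpsC (coefs f 0) *: y.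
Proof.
have [g {1}->] := fps_headE f.
by rewrite scalerDl [X * g]mulrC -scalerA X0 scaler0 addr0.
Qed.

(** The nilpotent kernels of [psi] stop growing at some [l]. Writing y = psi^l z, psi(y) = 0 puts
    [z] in the kernel of psi^(l+1), hence in that of psi^l. *)
Lemma psi_surj_inj : (forall y : M, exists z, y = psi z) ->
  forall y : M, psi y = 0 -> y = 0.
Proof.
move=> psi_surj y y0; have [l lP] := psi_nil_bound M.
have [z zE] : exists z, y = iter l psi z.
  elim: (l) => [|k [z zE]]; first by exists y.
  by have [z' z'E] := psi_surj z; exists z'; rewrite iterSr -z'E.
have zl : psi_nil l.+1 z.
  move=> f; rewrite scale_constE.
  have -> k : iter k psi (fpsC (coefs f 0) *: z) = fpsC (coefs f 0) *: iter k psi z.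
    by elim: k => //= k ->; rewrite psi_scaleC.
  by rewrite iterS -zE y0 scaler0.
by rewrite zE -[z]scale1r (lP _ _ zl).
Qed.

End KilledByX.

(** * The quotient A / K attached to an irreducible subrepresentation *)

Section IrreducibleSubrepresentation.
Variables (p : nat) (p_pr : prime p) (E : fieldType) (chE : p \in [pchar E]).
Variables (chi : padic p_pr -> E) (chi1 : chi 1 = 1).
Variables (M : psiGamma p_pr E) (Sigma : set (zseq M)).
Hypothesis Sigma_sub : closed_subrep chi (limpsi (M := M)) Sigma.
Hypothesis Sigma_infdim : infinite_dimensional Sigma.
Hypothesis Sigma_irr : topologically_irreducible chi Sigma.
Local Notation X := (fpsX : fps E).

Let A := pr0_closure Sigma.
Let sA : sub_psiGamma A := pr0_closure_sub chE chi1 Sigma_sub.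
Let SE : Sigma = limsub A := SigmaE chE chi1 Sigma_sub.
Let SL : Sigma `<=` limpsi (M := M). Proof. by case: Sigma_sub. Qed.
Let SA y i : Sigma y -> A (y i). Proof. by rewrite SE => -[_]. Qed.
Let Apsi : forall y, A y -> A (psi y). Proof. by case: sA. Qed.
Let A0 : A 0. Proof. by case: sA. Qed.
Let AD : forall y z, A y -> A z -> A (y + z). Proof. by case: sA. Qed.
Let AZ : forall f y, A y -> A (f *: y). Proof. by case: sA. Qed.
Let Agam : forall a y, a \is a GRing.unit -> A y -> A (gam a y). Proof. by case: sA. Qed.

Let K : set M := [set y | A y /\ exists k, psi_nil k y].

Let sK : sub_psiGamma K.
Proof.
split.
- split; first exact: A0.
  by exists 0%N; exact: (submodule0 (psi_nil_submodule M 0)).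
- move=> y z [Ay [k yk]] [Az [l zl]]; split; first exact: AD.
  exists (maxn k l); apply: (submoduleD (psi_nil_submodule M _)).
    exact: psi_nil_mon (leq_maxl _ _) _ yk.
  exact: psi_nil_mon (leq_maxr _ _) _ zl.
- move=> f y [Ay [k yk]]; split; first exact: AZ.
  by exists k; exact: (submoduleZ (psi_nil_submodule M k)).
- move=> y [Ay [k yk]]; split; first exact: Apsi.
  by exists k => f; rewrite -psiZ -iterSr iterS yk psi0.
- move=> a y ua [Ay [k yk]]; split; first exact: Agam.
  exists k => f; rewrite scale_gam //.
  have gk j z : iter j psi (gam a z : M) = gam a (iter j psi z).
    by elim: j => //= j ->; rewrite psi_gam.
  by rewrite gk yk -[0 in LHS](subrr 0) gamB // subrr.
Qed.

Let KA : K `<=` A. Proof. by move=> y []. Qed.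

Local Notation N := (subquot_psiGamma sA sK KA).
Local Notation pi := (pgproj sA sK KA).

Let ex_m : exists m, forall y, K y -> iter m psi y = 0.
Proof.
have [m mP] := psi_nil_bound M; exists m => y [_ [k /mP yk]].
by rewrite -[y]scale1r yk.
Qed.

(** A trivial limit leaves only the nilpotent alternative, and stability of [S] under scalars
    upgrades it to membership in [psi_nil k]. *)
Lemma limsub_trivial_nilp S : sub_psiGamma S -> S `<=` A -> limsub S = [set 0] -> S `<=` K.
Proof.
move=> sS SsA lS; have [_ _ SZ Spsi _] := sS.
have [[k kP]|[u uL [u0 uS]]] := psi_nilpotent_or_limpsi (sub_psiGamma_submodule sS) Spsi.
  by move=> y Sy; split; [exact: SsA|exists k => f; apply: kP; exact: SZ].
by case: u0; have : limsub S u by []; rewrite lS.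
Qed.

(** The components y_0 are dense in [A] and lie in [S], which is X-adically closed. *)
Lemma limsub_full S : sub_psiGamma S -> limsub S = Sigma -> A `<=` S.
Proof.
move=> sS lS a aA; have [s sM] := pg_lspan M.
apply: (krull_closed sM (sub_psiGamma_submodule sS)) => n.
have [y Sy [w ->]] := aA n; exists (y 0); last by exists w.
by move: Sy; rewrite -lS => -[_].
Qed.

(** The preimage [T] in [A] of a submodule of the quotient has as limit a closed subrepresentation
    of [Sigma]. If that is zero, [T] lies in [K]; if it is [Sigma], [T] is all of [A]. *)
Lemma subquot_irreducible : irreducible_psiGamma N.
Proof.
move=> S [S0 SD SZ Spsi Sgam].
pose T : set M := [set y | A y /\ S (pi y)].
have sT : sub_psiGamma T.
  split.
  - split; first exact: A0.
    by rewrite (_ : pi 0 = 0).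
  - move=> y z [Ay Sy] [Az Sz]; split; first exact: AD.
    by rewrite pgprojD //; exact: SD.
  - move=> f y [Ay Sy]; split; first exact: AZ.
    by rewrite pgprojZ //; exact: SZ.
  - move=> y [Ay Sy]; split; first exact: Apsi.
    by rewrite -(pgproj_psi sA sK KA 1) //; exact: Spsi.
  - move=> a y ua [Ay Sy]; split; first exact: Agam.
    by rewrite -pgproj_gam //; exact: Sgam.
have TA : T `<=` A by move=> y [].
have TS : closed_subrep chi Sigma (limsub T).
  apply: limsub_closed_subrep => // y [yL yT].
  by rewrite SE; split=> // i; exact: TA.
have [T0|T1] := Sigma_irr TS.
  left; apply/seteqP; split=> [q Sq|_ ->//].
  rewrite -(pgvalK q); apply/pgproj_eq0; first exact: pgval_in.
  apply: limsub_trivial_nilp sT TA T0 _ _.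
  by split; [exact: pgval_in|rewrite pgvalK].
right; apply/seteqP; split=> // q _; rewrite -(pgvalK q).
by have [] := limsub_full sT T1 (pgval_in q).
Qed.

Lemma subquot_rep_isomorphic : rep_isomorphic chi Sigma (limpsi (M := N)).
Proof.
have [m mK] := ex_m.
(* As psi^m kills [K], psi^m of a lift only depends on the class lifted. *)
have mE y z : A y -> A z -> pi y = pi z -> iter m psi y = iter m psi z.
  move=> Ay Az /pgproj_eq yz; apply/eqP; rewrite -subr_eq0 -iter_psiB.
  by apply/eqP/mK; exact: yz.
exists (fun y i => pi (y i)), (fun u i => iter m psi (pgval (u (i + m%:Z)))).
split; [split| split| |].
- move=> y Sy i; rewrite -[LHS]/(iter 1 psi _) pgproj_psi; last exact: SA.
  by rewrite /= (SL Sy).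
- move=> u uL; rewrite SE; split=> i; last by apply: (sub_iter_psi m Apsi); exact: pgval_in.
  rewrite -iterS iterSr; apply: mE; [by apply: Apsi; exact: pgval_in|exact: pgval_in|].
  rewrite -(pgproj_psi sA sK KA 1); last exact: pgval_in.
  rewrite !pgvalK /= -(uL (i + m%:Z)). by congr (psi (u _)); lia.
- move=> y Sy; apply: funext => i; rewrite -(limpsi_iter m i (SL Sy)).
  by apply: mE; [exact: pgval_in|exact: SA|rewrite pgvalK].
- move=> u uL; apply: funext => i; rewrite -pgproj_psi; last exact: pgval_in.
  by rewrite pgvalK limpsi_iter.
- have [c cP] := pgproj_close sA sK KA.
  apply: zseq_continuous => y i n Sy; exists `|i|%N, (n + c)%N => z Sz yz.
  by have [w zE] := yz i (leqnn _); apply: cP zE; exact: SA.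
(* The inverse map reads index i + m and applies [psi] [m] times, hence the precision p^m n. *)
- apply: zseq_continuous => u i n uL; exists (absz (i + m%:Z)), (p ^ m * n)%N => v vL uv.
  have [w vE] := uv _ (leqnn _).
  exists (iter m psi (pgval w)); rewrite -iter_psi_XnM -iter_psiD.
  have Aw : A (X ^+ (p ^ m * n) *: pgval w) by apply: AZ; exact: pgval_in.
  apply: mE; [exact: pgval_in|apply: AD => //; exact: pgval_in|].
  rewrite pgprojD //; last exact: pgval_in.
  by rewrite pgprojZ ?pgvalK //; exact: pgval_in.
- move=> c y z Sy Sz; apply: funext => i.
  have -> : (fpsC c *: y + z) i = fpsC c *: y i + z i by [].
  rewrite pgprojD ?pgprojZ //; try exact: SA.
  by apply: AZ; exact: SA.
- by move=> g y bg Sy; apply: pgproj_borel_act => // i; exact: SA.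
Qed.

(** Density of the components y_0 in [A] becomes density of their images in the quotient, with a
    loss of the Artin-Rees constant. *)
Let pi_surj_mod n (q : N) : exists2 y, Sigma y & exists w, q = pi (y 0) + X ^+ n *: w.
Proof.
have [c cP] := pgproj_close sA sK KA.
have [y Sy [w qE]] := pgval_in q (n + c)%N; exists y => //.
have [|||v vE] := cP n (y 0) (pgval q) w => //; first exact: SA.
  exact: pgval_in.
by exists v; rewrite -vE pgvalK.
Qed.

(** If the kernel of X is not zero, it is all of [N] by irreducibility. Then [N] is finite
    dimensional with [psi] injective, an element of [Sigma] is determined by the image of its
    component of index 0, and [Sigma] would be finite dimensional. *)
Lemma subquot_torsion_free (q : N) : X *: q = 0 -> q = 0.
Proof.
have [T0|T1] := subquot_irreducible (@ker_X_sub_psiGamma _ _ _ N).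
  by move=> q0; have : [set q : N | X *: q = 0] q by []; rewrite T0.
case: Sigma_infdim.
have X0 (r : N) : X *: r = 0 by have : [set q : N | X *: q = 0] r by rewrite T1.
(* When X kills [N], density modulo X is surjectivity. *)
have pi_surj (r : N) : exists y, Sigma y /\ pi (y 0) = r.
  have [y Sy [w ->]] := pi_surj_mod 1 r.
  by exists y; rewrite expr1 X0 addr0.
have psi_inj : forall r : N, psi r = 0 -> r = 0.
  apply: psi_surj_inj X0 _ => r; have [y [Sy <-]] := pi_surj r.
  exists (pi (y 1)); rewrite -[RHS]/(iter 1 psi _) pgproj_psi; last exact: SA.
  by have := limpsi_iter 1 0 (SL Sy); rewrite add0r => ->.
have [n [e eP]] := pg_fingen N.
have [y yP] := choice (fun i => pi_surj (e i)).
exists n, y; split=> [i|z Sz]; first exact: (yP i).1.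
(* Series act on [N] through their constant terms, so these are coordinates over [E]. *)
have [c cE] := eP (pi (z 0)); exists (fun i => coefs (c i) 0).
have [_ _ _ Slin _] := Sigma_sub.
have S0 : Sigma 0 by case: Sigma_sub.
have [Sw wE] : Sigma (\sum_i fpsC (coefs (c i) 0) *: y i) /\
    pi ((\sum_i fpsC (coefs (c i) 0) *: y i : zseq M) 0) = pi (z 0).
  rewrite cE; elim/big_rec2: _ => [|i r u _ [Su <-]].
    by [].
  split; first by apply: Slin => //; exact: (yP i).1.
  have -> : (fpsC (coefs (c i) 0) *: y i + u) 0 = fpsC (coefs (c i) 0) *: y i 0 + u 0 by [].
  rewrite pgprojD; [|by apply: AZ; exact: SA (yP i).1|exact: SA].
  by rewrite pgprojZ ?(yP i).2 -?scale_constE //; exact: SA (yP i).1.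
set w := \sum_i _ in Sw wE *.
have Sd : Sigma (fpsC (-1) *: w + z) by exact: Slin.
set d := fpsC (-1) *: w + z in Sd.
have [m mK] := ex_m.
have dC i : d i = z i - w i.
  rewrite -[LHS]/(fpsC (-1) *: w i + z i) addrC; congr (_ + _).
  have -> : fpsC (-1) = -1 :> fps E by apply/fpsP => -[|j] //=; rewrite oppr0.
  by rewrite scaleN1r.
have iter_inj k (r : N) : iter k psi r = 0 -> r = 0.
  by elim: k => // k IHk /psi_inj.
have piS (u : zseq M) i : Sigma u -> pi (u i) = 0 -> pi (u (i + 1)) = 0 /\ pi (u (i - 1)) = 0.
  move=> Su u0; split.
    apply: psi_inj; rewrite -[LHS]/(iter 1 psi _) pgproj_psi /=; last exact: SA.
    by rewrite (SL Su).
  have <- := SL Su (i - 1); rewrite subrK -(pgproj_psi sA sK KA 1); last exact: SA.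
  by rewrite u0 iter_psi0.
(* Vanishing at index 0 spreads upwards by injectivity of [psi] and downwards by applying [psi]. *)
have d0 i : pi (d i) = 0.
  have d00 : pi (d 0) = 0.
    apply/pgproj_eq0; first exact: SA.
    by rewrite dC; apply/(pgproj_eq sA sK KA); [exact: SA|exact: SA|].
  elim/int_rec: i => // k IHk.
    by rewrite -addn1 PoszD; exact: (piS _ _ Sd IHk).1.
  by rewrite -addn1 PoszD opprD; exact: (piS _ _ Sd IHk).2.
apply: funext => i; apply/eqP; rewrite -subr_eq0 -dC; apply/eqP.
(* All components of [d] lie in [K], and d_i = psi^m(d_(i+m)) with psi^m zero on [K]. *)
rewrite -(limpsi_iter m i (SL Sd)); apply: mK.
by apply/(pgproj_eq0 sA sK KA); [exact: SA|exact: d0].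
Qed.

Lemma exists_subquot : exists N : psiGamma p_pr E,
  [/\ irreducible_psiGamma N, rep_isomorphic chi Sigma (limpsi (M := N))
    & forall q : N, fpsX *: q = 0 -> q = 0].
Proof.
exists N; split; [exact: subquot_irreducible|exact: subquot_rep_isomorphic|].
exact: subquot_torsion_free.
Qed.

End IrreducibleSubrepresentation.

Local Close Scope classical_set_scope.

Theorem theorem4p2 (p : nat) (p_pr : prime p) (E : fieldType)
    (chE : p \in [pchar E])
    (chi : padic p_pr -> E) (chi_smooth : smooth_character chi)
    (M : psiGamma p_pr E) (Sigma : set (zseq M))
    (Sigma_sub : closed_subrep chi (limpsi (M := M)) Sigma)
    (Sigma_infdim : infinite_dimensional Sigma)
    (Sigma_irr : topologically_irreducible chi Sigma) :
  exists N : psiGamma p_pr E,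
    [/\ irreducible_psiGamma N, free_psiGamma N
      & rep_isomorphic chi Sigma (limpsi (M := N))].
Proof.
have [chi1 _ _] := chi_smooth.
have [N [Nirr Niso Ntf]] := exists_subquot chE chi1 Sigma_sub Sigma_infdim Sigma_irr.
exists N; split=> //; have [s sN] := pg_lspan N.
(* A finitely generated module without X-torsion is free, E[[X]] being a discrete valuation ring. *)
exact: torsion_free_basis sN Ntf.
Qed.
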